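(* Let $p$ be an odd prime. Let $1\le k<p^2-1$, and write uniquely $k=d+j(p-1)$ with $1\le d\le p-1$ and $j\ge0$. Then $$W_k=\binom{d-1}{j}\lambda_d+\mathbf 1_{d=1}\,c_j\qquad\text{in }\mathbf F_p,$$ where $\binom{d-1}{j}=0$ for $j>d-1$ and $\mathbf 1_{d=1}$ equals $1$ if $d=1$ and $0$ otherwise.
   Context: $p$ is an odd prime. The Artin--Hasse exponential is $\operatorname{AH}_p(X)=\exp\left(\sum_{i\ge0}X^{p^i}/p^i\right)=\sum_{n\ge0}u_nX^n\in\mathbf Z_p[[X]]$, $a_n\in\mathbf F_p$ is the reduction of $u_n$ modulo $p$, and $W_k=\sum_{r=0}^k(-1)^r r\,a_{rp}a_{(k-r)p}\in\mathbf F_p$. Let $w_p=\frac{(p-1)!+1}{p}\bmod p$ and let $B_n$ be the Bernoulli numbers with $B_1=-1/2$. In $\mathbf F_p$ put $\lambda_1=w_p$ and $\lambda_d=B_{p-d}/d$ for $2\le d\le p-1$. For $1\le m\le p-1$ put $\mathfrak h_m^{(1)}=\sum_{r=1}^m\frac1r\in\mathbf F_p$. For $j\ge0$ set $c_j=(-1)^{j-2}\mathfrak h_{j-1}^{(1)}$ if $2\le j\le p-1$, and $c_j=0$ if $j=0,1$ or $j\ge p$. *)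

(* Defs.v *)
From mathcomp Require Import all_boot all_order all_algebra.
Set Implicit Arguments.
Unset Strict Implicit.
Unset Printing Implicit Defensive.

Import Order.TTheory GRing.Theory Num.Theory.
Local Open Scope ring_scope.

(* A formal power series over rat is represented by its coefficient sequence
   f : nat -> rat.  When f 0 = 0, the coefficient of X^n in
   exp f = \sum_(m >= 0) f^m / m! only receives contributions from m <= n, and
   those only depend on f 0, ..., f n; it is thus computed on truncations. *)
Definition fps_exp (f : nat -> rat) (n : nat) : rat :=
  (\sum_(m < n.+1) (m`!%:R)^-1 *: (\poly_(i < n.+1) f i) ^+ m)`_n.

(* Coefficient of X^n in \sum_(i >= 0) X^(p^i) / p^i, for p > 1
   (p ^ i = n forces i <= n). *)
Definition AH_log (p n : nat) : rat :=
  \sum_(i < n.+1 | (p ^ i == n)%N) ((p ^ i)%:R)^-1.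

Definition AH_coef (p : nat) : nat -> rat := fps_exp (AH_log p).

(* ratr x is numerator / denominator computed in 'F_p, which is the reduction
   modulo p of x when x is p-integral (a rational in Z_p); it is only meant to
   be applied to such x. *)
Definition redp (p : nat) (x : rat) : 'F_p := ratr x.

Definition AH_coef_modp (p n : nat) : 'F_p := redp p (AH_coef p n).

Definition W (p k : nat) : 'F_p :=
  \sum_(r < k.+1)
    (-1) ^+ r * r%:R * AH_coef_modp p (r * p) * AH_coef_modp p ((k - r) * p).

(* The division is exact for p prime, by Wilson's theorem. *)
Definition wilson_quotient (p : nat) : 'F_p := (((p.-1)`! + 1) %/ p)%N%:R.

(* Bernoulli numbers, with B_1 = -1/2, through the recurrence
   \sum_(i <= n) 'C(n + 1, i) B_i = 0 for n > 0; see bernoulliE. *)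
Fixpoint bernoulli_seq (n : nat) : seq rat :=
  if n is m.+1 then
    let s := bernoulli_seq m in
    rcons s (if m == 0%N then 1
             else - (m.+1%:R)^-1 * \sum_(i < m) 'C(m.+1, i)%:R * s`_i)
  else [::].

Definition bernoulli (n : nat) : rat := (bernoulli_seq n.+1)`_n.

Lemma size_bernoulli_seq n : size (bernoulli_seq n) = n.
Proof. by elim: n => //= n IHn; rewrite size_rcons IHn. Qed.

Lemma nth_bernoulli_seq n i : (i < n)%N -> (bernoulli_seq n)`_i = bernoulli i.
Proof.
elim: n => // n IHn; rewrite ltnS leq_eqVlt => /orP[/eqP-> //|lt_in].
by rewrite -IHn //= nth_rcons size_bernoulli_seq lt_in.
Qed.

Lemma bernoulli0 : bernoulli 0 = 1.
Proof. by []. Qed.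

Lemma bernoulliE n : (0 < n)%N ->
  \sum_(i < n.+1) 'C(n.+1, i)%:R * bernoulli i = 0.
Proof.
move=> n_gt0; rewrite big_ord_recr /= {2}/bernoulli /=.
rewrite nth_rcons size_bernoulli_seq ltnn eqxx eqn0Ngt n_gt0 /=.
rewrite binSn mulrA mulrN mulfV ?pnatr_eq0 // mulN1r.
apply/eqP; rewrite subr_eq0; apply/eqP; apply: eq_bigr => i _.
by rewrite nth_bernoulli_seq.
Qed.

Lemma bernoulli1 : bernoulli 1 = - 2%:R^-1.
Proof. by rewrite /bernoulli /= big_ord1 /= bin0 !mulr1. Qed.

(* Meant for 1 <= d <= p - 1. *)
Definition lambda (p d : nat) : 'F_p :=
  if d == 1%N then wilson_quotient p
  else redp p (bernoulli (p - d)) / d%:R.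

Definition harmonic_modp (p m : nat) : 'F_p :=
  \sum_(1 <= r < m.+1) (r%:R)^-1.

Definition c (p j : nat) : 'F_p :=
  if (2 <= j <= p.-1)%N then (-1) ^+ (j - 2) * harmonic_modp p (j - 1)
  else 0.

(* Main.v *)
From HB Require Import structures.
From mathcomp Require Import all_boot all_order all_algebra all_field.
From mathcomp.classical Require Import boolp.
From mathcomp Require Import ring zify.
Require Import Defs.

Set Implicit Arguments.
Unset Strict Implicit.
Unset Printing Implicit Defensive.
Import GRing.Theory Num.Theory.
Local Open Scope ring_scope.

(** Write U = AH_p(X) over the ring of p-integral rationals, and split it as
    U = sum_(i < p) X^i U_i(X^p), so that G = U_0 mod p is the series of the
    a_(rp).  Then W_k is the coefficient of Y^k in theta(G(-Y)) G(Y), where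
    theta = Y d/dY.  The theorem follows from a product formula for this series.
    Put L(Y) = Y + Y^p + Y^(p^2) + ... and l = L mod p, so that l - l^p = Y.

    The logarithmic derivative of U gives theta_X U = L(X) U.  Read in each
    residue class of exponents (residue_part_ode), it says that the operator
    D = p theta - L satisfies (D + i) U_i = U_(i-1) and D U_0 = Y U_(p-1), whence
    D (D - 1) ... (D - p + 1) U_0 = Y U_0.  Let F(T) = T (T - 1) ... (T - p + 1).
    As F = T^p - T modulo p, the derivative of F is -1 and its second derivative
    is 0; expanding the operator F(p theta - L) modulo p^2 gives
    F(-L) U_0 - p theta U_0 = Y U_0, that is theta G = h G with
    p h = F(-L) - Y (theta_residue_part0).

    Modulo p the same relations express every U_i in terms of G and l, and the
    terms of degree divisible by p in U(X) U(-X) = 1 yield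
    G(Y) G(-Y) = 1 - l^(p-1) (residue_part0_alt_mul).  So
    theta(G(-Y)) G(Y) = h(-Y) (1 - l^(p-1)), with p h(-Y) = F(L) + Y.

    Write F = T^p - T + p Q.  Then h(-Y) = Q(l) + (L^p - L + Y) / p.
    The factor 1 - l^(p-1) is Y / l, and l = Y + Y^p up to degree p^2; so the
    monomial q_d T^d of Q contributes
    q_d Y l^(d-1) = q_d sum_j C(d-1, j) Y^(d + j(p-1)), and the binomial expansion
    of (Y + Y^p)^p / p, multiplied by Y / l, contributes the numbers c_j at the
    exponents 1 + j(p-1).
    Finally q_1 is the Wilson quotient, and for d > 1 the equation for
    F(T) - F(T - 1) = p (T - 1) ... (T - p + 1), divided by p, becomes the
    recurrence of the Bernoulli numbers, so that q_d = B_(p-d) / d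
    (divided_falling_bernoulli).

    The p-integrality of AH_p, without which reduction modulo p has no meaning,
    is obtained from U(X)^p = U(X^p) exp(pX) (AH_pint). *)

(** * Formal power series *)

(** A series is its sequence of coefficients; equality and choice on this type
    come from classical logic, as a ring structure requires them. *)
Record fps (R : Type) := Fps { fps_coef :> nat -> R }.

HB.instance Definition _ (R : Type) := gen_eqMixin (fps R).
HB.instance Definition _ (R : Type) := gen_choiceMixin (fps R).

Lemma fpsP (R : Type) (f g : fps R) : f =1 g -> f = g.
Proof. by case: f g => f [g] /= /funext ->. Qed.

Section FpsRing.
Variable R : comNzRingType.
Implicit Types (f g h : fps R) (P Q : {poly R}).

Definition fps_of_poly P : fps R := Fps (fun n => P`_n).
Definition trunc N f : {poly R} := \poly_(i < N) f i.

Lemma coef_trunc N f i : (i < N)%N -> (trunc N f)`_i = f i.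
Proof. by move=> lt_iN; rewrite coef_poly lt_iN. Qed.

Definition add_fps f g : fps R := Fps (fun n => f n + g n).
Definition opp_fps f : fps R := Fps (fun n => - f n).
Definition mul_fps f g : fps R :=
  Fps (fun n => \sum_(i < n.+1) f i * g (n - i)%N).

Fact add_fpsA : associative add_fps.
Proof. by move=> f g h; apply: fpsP => n /=; rewrite addrA. Qed.
Fact add_fpsC : commutative add_fps.
Proof. by move=> f g; apply: fpsP => n /=; rewrite addrC. Qed.
Fact add_0fps : left_id (fps_of_poly 0) add_fps.
Proof. by move=> f; apply: fpsP => n /=; rewrite coef0 add0r. Qed.
Fact add_Nfps : left_inverse (fps_of_poly 0) opp_fps add_fps.
Proof. by move=> f; apply: fpsP => n /=; rewrite coef0 addNr. Qed.

HB.instance Definition _ :=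
  GRing.isZmodule.Build (fps R) add_fpsA add_fpsC add_0fps add_Nfps.

(** A coefficient of a product only depends on finitely many coefficients of
    the factors, so that ring identities are inherited from polynomials. *)
Lemma mul_fps_poly N f g P Q : (forall i, (i < N)%N -> P`_i = f i) ->
    (forall i, (i < N)%N -> Q`_i = g i) ->
  forall i, (i < N)%N -> (P * Q)`_i = mul_fps f g i.
Proof.
move=> Pf Qg i lt_iN; rewrite coefM /=; apply: eq_bigr => j _.
by rewrite Pf ?Qg //; apply: leq_ltn_trans lt_iN; rewrite ?leq_subr ?leq_ord.
Qed.

Fact mul_fpsA : associative mul_fps.
Proof.
move=> f g h; apply: fpsP => n.
have t u := @coef_trunc n.+1 u; have m := @mul_fps_poly n.+1.
rewrite -(m _ _ _ _ (t f) (m _ _ _ _ (t g) (t h))) //.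
by rewrite -(m _ _ _ _ (m _ _ _ _ (t f) (t g)) (t h)) // mulrA.
Qed.
Fact mul_fpsC : commutative mul_fps.
Proof.
move=> f g; apply: fpsP => n; have t u := @coef_trunc n.+1 u.
by rewrite -!(@mul_fps_poly n.+1 _ _ _ _ (t _) (t _)) // mulrC.
Qed.
Fact mul_1fps : left_id (fps_of_poly 1) mul_fps.
Proof.
move=> f; apply: fpsP => n; have t u := @coef_trunc n.+1 u.
by rewrite -(@mul_fps_poly n.+1 _ _ 1 _ _ (t _)) // mul1r t.
Qed.
Fact mul_fpsDl : left_distributive mul_fps add_fps.
Proof.
move=> f g h; apply: fpsP => n /=; rewrite -big_split /=.
by apply: eq_bigr => i _; rewrite mulrDl.
Qed.
Fact one_fps_neq0 : fps_of_poly 1 != 0.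
Proof.
by apply/eqP => /(congr1 (fun f : fps R => f 0)) /eqP; rewrite /= !coefE oner_eq0.
Qed.

HB.instance Definition _ :=
  GRing.Zmodule_isComNzRing.Build (fps R)
    mul_fpsA mul_fpsC mul_1fps mul_fpsDl one_fps_neq0.

Lemma coef_fps0 n : (0 : fps R) n = 0. Proof. by rewrite /= coef0. Qed.
Lemma coef_fps1 n : (1 : fps R) n = (n == 0)%:R.
Proof. by rewrite /= coef1. Qed.
Lemma coef_fpsD f g n : (f + g) n = f n + g n. Proof. by []. Qed.
Lemma coef_fpsN f n : (- f) n = - f n. Proof. by []. Qed.
Lemma coef_fpsM f g n : (f * g) n = \sum_(i < n.+1) f i * g (n - i)%N.
Proof. by []. Qed.
Lemma coef_fps_sum I (r : seq I) (S : pred I) (F : I -> fps R) n :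
  (\sum_(i <- r | S i) F i) n = \sum_(i <- r | S i) F i n.
Proof.
by elim/big_rec2: _ => [|i x f _ <-]; rewrite ?coef_fps0 // coef_fpsD.
Qed.
Lemma coef_fpsMn f m n : (f *+ m) n = f n *+ m.
Proof. by elim: m => [|m IHm]; rewrite ?coef_fps0 // !mulrS coef_fpsD IHm. Qed.
Lemma coef0_fpsM f g : (f * g) 0 = f 0 * g 0.
Proof. by rewrite coef_fpsM big_ord1. Qed.

Lemma coef_fpsM_poly N f g P Q : (forall i, (i < N)%N -> P`_i = f i) ->
    (forall i, (i < N)%N -> Q`_i = g i) ->
  forall i, (i < N)%N -> (P * Q)`_i = (f * g) i.
Proof. exact: mul_fps_poly. Qed.

Lemma coef_fpsX_poly N f P k : (forall i, (i < N)%N -> P`_i = f i) ->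
  forall i, (i < N)%N -> (P ^+ k)`_i = (f ^+ k) i.
Proof.
move=> Pf; elim: k => [|k IHk] i lt_iN; first by rewrite coef1 coef_fps1.
by rewrite !exprS; apply: coef_fpsM_poly lt_iN.
Qed.

Fact fps_of_poly_zmod : zmod_morphism fps_of_poly.
Proof. by move=> P Q; apply: fpsP => n; rewrite /= coefB. Qed.
Fact fps_of_poly_monoid : monoid_morphism fps_of_poly.
Proof.
split=> // P Q; apply: fpsP => n.
by rewrite -(@coef_fpsM_poly n.+1 _ _ P Q).
Qed.
HB.instance Definition _ :=
  GRing.isZmodMorphism.Build _ _ fps_of_poly fps_of_poly_zmod.
HB.instance Definition _ :=
  GRing.isMonoidMorphism.Build _ _ fps_of_poly fps_of_poly_monoid.

Definition fpsC : R -> fps R := fps_of_poly \o polyC.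
HB.instance Definition _ := GRing.RMorphism.on fpsC.
Definition fpsX : fps R := fps_of_poly 'X.

Lemma coef_fpsCM c f n : (fpsC c * f) n = c * f n.
Proof.
rewrite coef_fpsM big_ord_recl subn0 big1 /= ?coefC ?addr0 // => i _.
by rewrite /= coefC mul0r.
Qed.
Lemma coef_fpsXn m n : (fpsX ^+ m) n = (n == m)%:R.
Proof. by rewrite -rmorphXn /= coefXn. Qed.
Lemma coef_fpsXnM m f n :
  (fpsX ^+ m * f) n = if (n < m)%N then 0 else f (n - m)%N.
Proof.
rewrite -rmorphXn -(@coef_fpsM_poly n.+1 _ _ 'X^m (trunc n.+1 f)) //; last first.
  exact: coef_trunc.
by rewrite coefXnM; case: ifP => // _; rewrite coef_trunc // ltnS leq_subr.
Qed.
Lemma coef_fpsXM f n : (fpsX * f) n = if n is m.+1 then f m else 0.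
Proof. by rewrite -[fpsX]expr1 coef_fpsXnM; case: n => // n; rewrite subn1. Qed.

(** ** Congruence modulo a power of the variable *)

Definition eq_upto N f g := forall n, (n < N)%N -> f n = g n.

Lemma eq_upto_refl N f : eq_upto N f f. Proof. by []. Qed.
Lemma eq_upto_sym N f g : eq_upto N f g -> eq_upto N g f.
Proof. by move=> fg n /fg. Qed.
Lemma eq_upto_trans N g f h : eq_upto N f g -> eq_upto N g h -> eq_upto N f h.
Proof. by move=> fg gh n lt_nN; rewrite fg ?gh. Qed.
Lemma eq_uptoW M N f g : (M <= N)%N -> eq_upto N f g -> eq_upto M f g.
Proof. by move=> leMN fg n ltnM; apply/fg/leq_trans/leMN. Qed.
Lemma eq_uptoM N f f' g g' :
  eq_upto N f f' -> eq_upto N g g' -> eq_upto N (f * g) (f' * g').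
Proof.
move=> ff gg n lt_nN; rewrite !coef_fpsM; apply: eq_bigr => i _.
by rewrite ff ?gg //; apply: leq_ltn_trans lt_nN; rewrite ?leq_subr ?leq_ord.
Qed.
Lemma eq_uptoX N f g k : eq_upto N f g -> eq_upto N (f ^+ k) (g ^+ k).
Proof.
by move=> fg; elim: k => // k IHk; rewrite !exprS; apply: eq_uptoM.
Qed.
Lemma eq_upto_mulX N m f g :
  eq_upto (m + N) (fpsX ^+ m * f) (fpsX ^+ m * g) <-> eq_upto N f g.
Proof.
split=> fg n lt_n; last first.
  rewrite !coef_fpsXnM; case: ltnP => // le_mn; apply: fg.
  by rewrite ltn_subLR.
have := fg (m + n)%N; rewrite ltn_add2l !coef_fpsXnM addKn.
by rewrite (ltnNge _ m) leq_addr; apply.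
Qed.

(** ** Derivation, and the substitutions X -> c X and X -> X^m *)

(** The derivation X d/dX, which does not lower the exponents. *)
Definition theta f : fps R := Fps (fun n => f n *+ n).

Fact theta_zmod : zmod_morphism theta.
Proof. by move=> f g; apply: fpsP => n; rewrite /= mulrnBl. Qed.
HB.instance Definition _ := GRing.isZmodMorphism.Build _ _ theta theta_zmod.

Lemma coef_theta f n : theta f n = f n *+ n. Proof. by []. Qed.

Lemma thetaM f g : theta (f * g) = theta f * g + f * theta g.
Proof.
apply: fpsP => n; rewrite coef_theta coef_fpsD !coef_fpsM -sumrMnl -big_split /=.
apply: eq_bigr => i _; rewrite mulrnAl mulrnAr -mulrnDr subnKC //.
by rewrite -ltnS.
Qed.

Lemma thetaC c : theta (fpsC c) = 0.
Proof.
by apply: fpsP => -[|n]; rewrite coef_theta coef_fps0 // /= coefC mul0rn.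
Qed.

Lemma theta1 : theta 1 = 0.
Proof. by rewrite -(rmorph1 fpsC) thetaC. Qed.

Lemma thetaX : theta fpsX = fpsX.
Proof. by apply: fpsP => -[|[|n]]; rewrite coef_theta /= coefX ?mul0rn. Qed.

Lemma thetaXn f k : theta (f ^+ k.+1) = f ^+ k * theta f *+ k.+1.
Proof.
elim: k => [|k IHk]; first by rewrite expr1 expr0 mul1r.
rewrite exprS thetaM IHk [_ *+ k.+2]mulrS mulrnAr mulrA -exprS.
by rewrite [theta f * _]mulrC.
Qed.

Definition scaleX c f : fps R := Fps (fun n => c ^+ n * f n).

Fact scaleX_zmod c : zmod_morphism (scaleX c).
Proof. by move=> f g; apply: fpsP => n; rewrite /= mulrBr. Qed.
Fact scaleX_monoid c : monoid_morphism (scaleX c).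
Proof.
split=> [|f g]; apply: fpsP => n.
  by rewrite /= coef1; case: n => [|n]; rewrite ?mulr0 ?mulr1.
rewrite /= mulr_sumr; apply: eq_bigr => i _.
rewrite mulrACA -exprD subnKC //; by rewrite -ltnS.
Qed.
HB.instance Definition _ c :=
  GRing.isZmodMorphism.Build _ _ (scaleX c) (scaleX_zmod c).
HB.instance Definition _ c :=
  GRing.isMonoidMorphism.Build _ _ (scaleX c) (scaleX_monoid c).

Lemma coef_scaleX c f n : scaleX c f n = c ^+ n * f n. Proof. by []. Qed.
Lemma scaleXX c : scaleX c fpsX = fpsC c * fpsX.
Proof.
apply: fpsP => n; rewrite coef_scaleX coef_fpsCM /= coefX.
by case: n => [|[|n]]; rewrite ?mulr0.
Qed.
Lemma theta_scaleX c f : theta (scaleX c f) = scaleX c (theta f).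
Proof. by apply: fpsP => n; rewrite /= mulrnAr. Qed.

Definition dilate m f : fps R :=
  Fps (fun n => if (m %| n)%N then f (n %/ m)%N else 0).

Lemma coef_dilate_poly N m f P : (0 < m)%N -> (forall i, (i < N)%N -> P`_i = f i) ->
  forall i, (i < N)%N -> (P \Po 'X^m)`_i = dilate m f i.
Proof.
move=> m_gt0 Pf i lt_iN; rewrite coef_comp_poly_Xn //=; case: ifP => // _.
by rewrite Pf // (leq_ltn_trans (leq_div _ _)).
Qed.

Lemma dilateM m f g : (0 < m)%N -> dilate m (f * g) = dilate m f * dilate m g.
Proof.
move=> m_gt0; apply: fpsP => n; have t u := @coef_trunc n.+1 u.
have dil := @coef_dilate_poly n.+1 m _ _ m_gt0.
rewrite -(coef_fpsM_poly (dil _ _ (t f)) (dil _ _ (t g))) // -rmorphM.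
by rewrite -(dil _ _ (coef_fpsM_poly (t f) (t g))).
Qed.

Lemma theta_dilate m f : theta (dilate m f) = dilate m (theta f) *+ m.
Proof.
apply: fpsP => n; rewrite coef_fpsMn /=; case: ifP => [mn|_].
  by rewrite -[X in _ *+ X = _](divnK mn) mulrnA.
by rewrite !mul0rn.
Qed.

(** The p-th power is additive, and it fixes the coefficients. *)
Lemma fps_Frobenius p f : p \in [pchar R] -> (forall c : R, c ^+ p = c) ->
  f ^+ p = dilate p f.
Proof.
move=> pcharR frobR; apply: fpsP => n; have t := @coef_trunc n.+1 f.
have p_gt0 : (0 < p)%N by apply/prime_gt0/(pcharf_prime pcharR).
rewrite -(coef_fpsX_poly p t) // -(coef_dilate_poly p_gt0 t) //.
congr (_`_n); rewrite {1}/trunc poly_def.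
have charP : p \in [pchar {poly R}] by rewrite pchar_poly.
rewrite -(pFrobenius_autE charP) /trunc poly_def !rmorph_sum /=.
congr polyseq; apply: eq_bigr => i _; rewrite pFrobenius_autE exprZn frobR.
by rewrite linearZ /= rmorphXn /= comp_polyX -!exprM mulnC.
Qed.

(** As a has no constant term, the equation gives n f_n in terms of the
    coefficients of f of index less than n. *)
Lemma theta_unique (a f g : fps R) :
    (forall n (x y : R), (0 < n)%N -> x *+ n = y *+ n -> x = y) ->
    a 0 = 0 -> theta f = a * f -> theta g = a * g -> f 0 = g 0 -> f = g.
Proof.
move=> R_tf a0 f_ode g_ode fg0; apply: fpsP => n.
elim/ltn_ind: n => -[//|n] IHn; apply: (R_tf n.+1) => //.
rewrite -!coef_theta f_ode g_ode !coef_fpsM.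
rewrite [LHS]big_ord_recl [RHS]big_ord_recl a0 !mul0r; congr (_ + _).
apply: eq_bigr => i _; congr (_ * _); apply: IHn.
by rewrite /= /bump subSS ltnS leq_subr.
Qed.

(** ** Dissection of a series by the residue of the exponent *)

Section Sections.
Variable p : nat.
Hypothesis p_gt0 : (0 < p)%N.

Definition residue_part i f : fps R := Fps (fun r => f (r * p + i)%N).

Lemma coef_residue_part i f r : residue_part i f r = f (r * p + i)%N.
Proof. by []. Qed.

Fact residue_part_zmod i : zmod_morphism (residue_part i).
Proof. by move=> f g; apply: fpsP => n. Qed.
HB.instance Definition _ i :=
  GRing.isZmodMorphism.Build _ _ (residue_part i) (residue_part_zmod i).

Lemma residue_part_theta i f :
  residue_part i (theta f) = theta (residue_part i f) *+ p + residue_part i f *+ i.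
Proof.
by apply: fpsP => r; rewrite coef_fpsD !coef_fpsMn /= mulrnDr mulrnA.
Qed.

Lemma residue_partXM i f : residue_part i.+1 (fpsX * f) = residue_part i f.
Proof. by apply: fpsP => r; rewrite !coef_residue_part coef_fpsXM addnS. Qed.

Lemma residue_part0_XnM i f : (0 < i <= p)%N ->
  residue_part 0 (fpsX ^+ i * f) = fpsX * residue_part (p - i) f.
Proof.
case/andP=> i_gt0 le_ip; apply: fpsP => r.
rewrite coef_fpsXM coef_residue_part coef_fpsXnM addn0.
case: r => [|r]; first by rewrite mul0n i_gt0.
rewrite coef_residue_part mulSn ltnNge (leq_trans le_ip) ?leq_addr //=; congr (f _); lia.
Qed.

(** In the product only the exponents of f congruent to i contribute. *)
Lemma residue_part_dilateM i g f : (i < p)%N ->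
  residue_part i (dilate p g * f) = g * residue_part i f.
Proof.
move=> lt_ip; apply: fpsP => r; rewrite coef_residue_part !coef_fpsM.
rewrite [RHS](eq_bigr (fun s : 'I_r.+1 =>
    \sum_(t < (r * p + i).+1 | t == (s * p)%N :> nat)
       g s * f (r * p + i - t)%N)) => [|s _]; last first.
  have le_sr : (s * p <= r * p)%N by rewrite leq_mul2r -ltnS ltn_ord orbT.
  have lt_s : (s * p < (r * p + i).+1)%N.
    by rewrite ltnS (leq_trans le_sr) ?leq_addr.
  rewrite (big_pred1 (Ordinal lt_s)) // coef_residue_part /=.
  by rewrite mulnBl addnBAC.
rewrite (exchange_big_dep xpredT) //=; apply: eq_bigr => t _.
case: ifPn => [/dvdnP[s t_eq]|p'_t]; last first.
  rewrite mul0r big_pred0 // => s; apply: contraNF p'_t => /eqP->.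
  exact: dvdn_mull.
have lt_sr : (s < r.+1)%N.
  have: (s * p < r.+1 * p)%N by have := ltn_ord t; rewrite t_eq mulSn; lia.
  by rewrite ltn_mul2r p_gt0.
rewrite t_eq mulnK // (big_pred1 (Ordinal lt_sr)) //= => s'.
by rewrite /= eqn_mul2r (gtn_eqF p_gt0) eq_sym.
Qed.

Lemma residue_part_decomp f :
  f = \sum_(i < p) fpsX ^+ i * dilate p (residue_part i f).
Proof.
apply: fpsP => n; rewrite coef_fps_sum (bigD1 (Ordinal (ltn_pmod n p_gt0))) //.
rewrite big1 => [|i ne_in].
  rewrite coef_fpsXnM ltnNge leq_mod /= addr0.
  have -> : (n - n %% p = n %/ p * p)%N by rewrite {1}(divn_eq n p) addnK.
  by rewrite dvdn_mull // mulnK // -divn_eq.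
rewrite coef_fpsXnM; case: ltnP => //= le_in; case: ifP => // /dvdnP[s ns].
have n_eq : n = (s * p + i)%N by lia.
by case/eqP: ne_in; apply/val_inj; rewrite /= n_eq modnMDl modn_small.
Qed.

End Sections.
End FpsRing.

Arguments fpsX {R}.

Section MapFps.
Variables (R S : comNzRingType) (phi : {rmorphism R -> S}).

Definition map_fps (f : fps R) : fps S := Fps (fun n => phi (f n)).

Fact map_fps_zmod : zmod_morphism map_fps.
Proof. by move=> f g; apply: fpsP => n; rewrite /= rmorphB. Qed.
Fact map_fps_monoid : monoid_morphism map_fps.
Proof.
split=> [|f g]; apply: fpsP => n; rewrite /=; first by rewrite !coef1 rmorph_nat.
by rewrite rmorph_sum; apply: eq_bigr => i _; rewrite rmorphM.
Qed.
HB.instance Definition _ := GRing.isZmodMorphism.Build _ _ map_fps map_fps_zmod.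
HB.instance Definition _ :=
  GRing.isMonoidMorphism.Build _ _ map_fps map_fps_monoid.

Lemma coef_map_fps f n : map_fps f n = phi (f n). Proof. by []. Qed.
Lemma map_fpsC c : map_fps (fpsC c) = fpsC (phi c).
Proof. by apply: fpsP => n; rewrite /= !coefC; case: eqP; rewrite ?rmorph0. Qed.
Lemma map_fpsX : map_fps fpsX = fpsX.
Proof. by apply: fpsP => n; rewrite /= !coefX rmorph_nat. Qed.
Lemma map_theta f : map_fps (theta f) = theta (map_fps f).
Proof. by apply: fpsP => n; rewrite /= rmorphMn. Qed.
Lemma map_dilate m f : map_fps (dilate m f) = dilate m (map_fps f).
Proof. by apply: fpsP => n /=; case: ifP; rewrite ?rmorph0. Qed.
Lemma map_residue_part p i f :
  map_fps (residue_part p i f) = residue_part p i (map_fps f).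
Proof. by apply: fpsP => n. Qed.
Lemma map_scaleX c f : map_fps (scaleX c f) = scaleX (phi c) (map_fps f).
Proof. by apply: fpsP => n; rewrite /= rmorphM rmorphXn. Qed.

End MapFps.

(** * The series X + X^p + X^(p^2) + ... *)

Definition pow_series (R : comNzRingType) p : fps R :=
  Fps (fun n => (p.-nat n)%:R).

Lemma map_pow_series (R S : comNzRingType) (phi : {rmorphism R -> S}) p :
  map_fps phi (pow_series R p) = pow_series S p.
Proof. by apply: fpsP => n; rewrite /= rmorph_nat. Qed.

Section PowSeries.
Variables (R : comNzRingType) (p : nat).
Hypothesis p_pr : prime p.
Let p_gt1 : (1 < p)%N := prime_gt1 p_pr.
Let p_gt0 : (0 < p)%N := prime_gt0 p_pr.
Local Notation L := (pow_series R p).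

Lemma pow_series0 : L 0 = 0. Proof. by []. Qed.

Lemma pow_series_split : L = fpsX + dilate p L.
Proof.
apply: fpsP => n; rewrite coef_fpsD /= coefX.
have [/dvdnP[m ->]|p'n] := boolP (p %| n)%N.
  rewrite mulnK //; case: (posnP m) => [->|m_gt0]; first by rewrite add0r.
  rewrite pnatM pnat_id // andbT (_ : _ == _ = false) ?add0r //.
  by rewrite muln_eq1 (gtn_eqF p_gt1) andbF.
rewrite addr0; congr (_%:R); congr nat_of_bool.
apply/idP/eqP => [/p_natP[[|k]//] n_eq|->//].
by case/negP: p'n; rewrite n_eq dvdn_exp.
Qed.

(** The next exponent is p^2. *)
Lemma pow_series_upto : eq_upto (p ^ 2) L (fpsX + fpsX ^+ p).
Proof.
move=> n lt_n; rewrite coef_fpsD coef_fpsXn -[fpsX]expr1 coef_fpsXn /=.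
have [/p_natP[k n_eq]|p'n] := boolP (p.-nat n).
  move: lt_n; rewrite n_eq ltn_exp2l //; case: k {n_eq} => [|[|//]] _.
    by rewrite expn0 (ltn_eqF p_gt1) addr0.
  by rewrite expn1 eqxx (gtn_eqF p_gt1) add0r.
case: eqP p'n => [->//|_]; case: eqP => [->|_ _]; last by rewrite add0r.
by rewrite pnat_id.
Qed.

Lemma pow_series_odd : odd p -> scaleX (-1) L = - L.
Proof.
move=> p_odd; apply: fpsP => n; rewrite coef_fpsN coef_scaleX /=.
case: (boolP (p.-nat n)) => [/p_natP[k ->]|]; last by rewrite mulr0 oppr0.
by rewrite mulr1 -signr_odd oddX p_odd orbT.
Qed.

End PowSeries.

Lemma Fp_expp p (p_pr : prime p) (c : 'F_p) : c ^+ p = c.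
Proof. by have := expf_card c; rewrite card_Fp. Qed.

(** Over F_p the shift L(X^p) is the power L^p. *)
Lemma pow_series_Frobenius p : prime p ->
  pow_series 'F_p p = fpsX + pow_series 'F_p p ^+ p.
Proof.
move=> p_pr; rewrite (fps_Frobenius _ (pchar_Fp p_pr) (Fp_expp p_pr)).
exact: pow_series_split.
Qed.

(** * Evaluation of a polynomial at a power series *)

Section FpsHorner.
Variables (R : comNzRingType).
Implicit Types (P Q : {poly R}) (f : fps R).

Definition fps_horner f P : fps R := (map_poly (@fpsC R) P).[f].
HB.instance Definition _ f := GRing.RMorphism.copy (fps_horner f)
  (horner_eval f \o map_poly (@fpsC R)).

Lemma fps_hornerX f : fps_horner f 'X = f.
Proof. by rewrite /fps_horner map_polyX hornerX. Qed.
Lemma fps_hornerC f c : fps_horner f c%:P = fpsC c.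
Proof. by rewrite /fps_horner map_polyC hornerC. Qed.
Lemma fps_hornerXsubC f c : fps_horner f ('X - c%:P) = f - fpsC c.
Proof. by rewrite rmorphB /= fps_hornerX fps_hornerC. Qed.
Lemma fps_hornerZXn f c n : fps_horner f (c *: 'X^n) = fpsC c * f ^+ n.
Proof. by rewrite -mul_polyC rmorphM rmorphXn /= fps_hornerC fps_hornerX. Qed.

(** The chain rule. *)
Lemma theta_horner f P : theta (fps_horner f P) = fps_horner f P^`() * theta f.
Proof.
elim/poly_ind: P => [|P c IHP]; first by rewrite deriv0 !rmorph0 raddf0 mul0r.
rewrite derivMXaddC rmorphD rmorphM /= fps_hornerC fps_hornerX raddfD /= thetaC.
rewrite addr0 thetaM IHP rmorphD rmorphM /= fps_hornerX mulrDl addrC.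
by congr (_ + _); rewrite -!mulrA [theta f * _]mulrC.
Qed.

End FpsHorner.

Lemma map_fps_horner (R S : comNzRingType) (phi : {rmorphism R -> S}) f P :
  map_fps phi (fps_horner f P) = fps_horner (map_fps phi f) (map_poly phi P).
Proof.
elim/poly_ind: P => [|P c IHP]; first by rewrite !rmorph0.
rewrite !rmorphD !rmorphM /= !map_polyC map_polyX /= !fps_hornerC !fps_hornerX.
by rewrite IHP map_fpsC.
Qed.

(** * The falling factorial polynomial modulo p *)

Definition falling (R : comNzRingType) n : {poly R} :=
  \prod_(i < n) ('X - i%:R%:P).

Section Falling.
Variables (R : comNzRingType).

Lemma falling0 : falling R 0 = 1. Proof. by rewrite /falling big_ord0. Qed.
Lemma fallingS n : falling R n.+1 = falling R n * ('X - n%:R%:P).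
Proof. by rewrite /falling big_ord_recr. Qed.
Lemma falling_monic n : falling R n \is monic.
Proof. exact: monic_prod_XsubC. Qed.
Lemma size_falling n : size (falling R n) = n.+1.
Proof. by rewrite /falling size_prod_XsubC /index_enum -enumT size_enum_ord. Qed.

End Falling.

Lemma map_falling (R S : comNzRingType) (phi : {rmorphism R -> S}) n :
  map_poly phi (falling R n) = falling S n.
Proof.
rewrite rmorph_prod; apply: eq_bigr => i _.
by rewrite rmorphB /= map_polyX map_polyC /= rmorph_nat.
Qed.

Section FallingFp.
Variable p : nat.
Hypothesis p_pr : prime p.

Lemma big_Fp (T : Type) (idx : T) (op : Monoid.com_law idx) (F : 'F_p -> T) :
  \big[op/idx]_(x : 'F_p) F x = \big[op/idx]_(i < p) F i%:R.
Proof.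
have Fp_p : p = (Zp_trunc (pdiv p)).+2 by rewrite Fp_cast.
rewrite [in RHS](big_ord_widen_cond _ (fun=> true) (fun i => F i%:R) (eq_leq Fp_p)).
rewrite [RHS](eq_bigl xpredT) => [|i]; last by rewrite /= {2}Fp_p ltn_ord.
by apply: eq_bigr => x _; rewrite natr_Zp.
Qed.

(** Its roots are all the elements of F_p. *)
Lemma falling_Fp : falling 'F_p p = 'X^p - 'X.
Proof.
by have := finField_genPoly 'F_p; rewrite card_Fp // (big_Fp _ (fun x => 'X - x%:P)).
Qed.

End FallingFp.

Lemma deriv_prod_nat (R : comNzRingType) (F : nat -> {poly R}) a n :
  (\prod_(a <= m < n) F m)^`() =
  \sum_(a <= i < n) (F i)^`() * (\prod_(a <= m < i) F m * \prod_(i.+1 <= m < n) F m).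
Proof.
elim: n => [|n IHn]; first by rewrite !big_geq // -polyC1 derivC.
have [lt_na|le_an] := ltnP n a; first by rewrite !big_geq // -polyC1 derivC.
rewrite [RHS]big_nat_recr // big_nat_recr //= derivM IHn mulr_suml.
rewrite (big_geq (leqnn _)) mulr1.
congr (_ + _); last by rewrite mulrC.
rewrite [LHS]big_nat [RHS]big_nat; apply: eq_bigr => i /andP[_ lt_in].
by rewrite big_nat_recr //= !mulrA.
Qed.

(** * Artin-Hasse series over a lift of F_p *)

(** The ring R stands for the p-integral rationals; what matters is that it is
    torsion-free and that its residue ring modulo p is F_p. *)

Section ArtinHasse.
Variables (p : nat) (R : comNzRingType) (red : {rmorphism R -> 'F_p}).
Hypothesis p_pr : prime p.
Hypothesis p_odd : odd p.
Hypothesis R_tf : forall n (x y : R), (0 < n)%N -> x *+ n = y *+ n -> x = y.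
Hypothesis red_ker : forall x, red x = 0 -> exists y, x = y *+ p.
Variable U : fps R.
Hypothesis U0 : U 0 = 1.
Hypothesis U_ode : theta U = pow_series R p * U.

Let p_gt0 : (0 < p)%N := prime_gt0 p_pr.
Let p_gt1 : (1 < p)%N := prime_gt1 p_pr.
Local Notation redf := (map_fps red).
Local Notation L := (pow_series R p).
Local Notation l := (pow_series 'F_p p).
Local Notation A i := (redf (residue_part p i U)).
Local Notation G := (A 0).
Local Notation alt := (scaleX (-1)).

Lemma fps_tf n (f g : fps R) : (0 < n)%N -> f *+ n = g *+ n -> f = g.
Proof.
move=> n_gt0 fg; apply: fpsP => i; apply: (R_tf n_gt0).
by rewrite -!coef_fpsMn fg.
Qed.

Lemma fps_red_ker f : redf f = 0 -> exists g, f = g *+ p.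
Proof.
move=> f0; have ker_f n : exists y, f n = y *+ p.
  by apply: red_ker; rewrite -coef_map_fps f0 coef_fps0.
have [g fg] := choice ker_f.
by exists (Fps g); apply: fpsP => n; rewrite coef_fpsMn fg.
Qed.

Lemma fps_Fp_mulrn (f : fps 'F_p) : f *+ p = 0.
Proof.
apply: fpsP => n.
by rewrite coef_fpsMn coef_fps0 (mulrn_pchar (pchar_Fp p_pr)).
Qed.

(** ** The differential equation of the series of the coefficients u_(rp) *)

(** Here f is a series in Y = X^p: on X^i f(X^p), the derivation X d/dX acts on f
    as p theta + i. *)
Definition pD (f : fps R) : fps R := theta f *+ p - L * f.

(** The two parts of L(X) = X + L(X^p) respectively shift and keep the residue. *)
Lemma residue_part_ode i : (i.+1 < p)%N ->
  pD (residue_part p i.+1 U) + residue_part p i.+1 U *+ i.+1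
  = residue_part p i U.
Proof.
move=> lt_ip; have := congr1 (residue_part p i.+1) U_ode.
rewrite residue_part_theta (pow_series_split R p_pr) mulrDl raddfD /=.
rewrite residue_partXM residue_part_dilateM // /pD => eq_i.
by rewrite addrAC eq_i addrK.
Qed.

Lemma residue_part0_ode :
  pD (residue_part p 0 U) = fpsX * residue_part p p.-1 U.
Proof.
have := congr1 (residue_part p 0) U_ode.
rewrite residue_part_theta (pow_series_split R p_pr) mulrDl raddfD /=.
rewrite -[fpsX in fpsX * U]expr1 residue_part0_XnM // residue_part_dilateM //.
by rewrite mulr0n addr0 /pD => ->; rewrite addrK subn1.
Qed.

Lemma pDXM f : pD (fpsX * f) = fpsX * (pD f + f *+ p).
Proof. by rewrite /pD thetaM thetaX; ring. Qed.

Fixpoint falling_pD f n : fps R :=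
  if n is n'.+1 then pD (falling_pD f n') - falling_pD f n' *+ n' else f.

(** Multiplication by X shifts pD by p, so the factor pD - (n + 1) becomes
    pD + (p - n - 1), which lowers the residue index by one. *)
Lemma falling_pD_residue_part n : (n < p)%N ->
  falling_pD (residue_part p 0 U) n.+1 = fpsX * residue_part p (p.-1 - n) U.
Proof.
elim: n => [|n IHn] lt_np; first by rewrite /= mulr0n subr0 subn0 residue_part0_ode.
rewrite [LHS]/= -/(falling_pD _ n.+1) IHn ?(ltnW lt_np) // pDXM.
have -> : (p.-1 - n = (p.-1 - n.+1).+1)%N by lia.
rewrite -(@residue_part_ode (p.-1 - n.+1)); last by lia.
rewrite -mulrnAr -mulrBr -addrA -mulrnBr; last by lia.
by congr (_ * (_ + _ *+ _)); lia.
Qed.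

Lemma falling_pD_p :
  falling_pD (residue_part p 0 U) p = fpsX * residue_part p 0 U.
Proof.
have := @falling_pD_residue_part p.-1; rewrite prednK // subnn leqnn; exact.
Qed.

(** Modulo p^2 the derivation acts at most once.  It acts either on f, which gives
    the derivative of the falling factorial P at -L, or on the factors -L that follow
    it, and each pair of factors then yields half of P''; doubling avoids the
    fraction. *)
Lemma falling_pD_expand (f : fps R) n : exists Z : fps R,
  falling_pD f n = fps_horner (- L) (falling R n) * f + Z *+ p /\
  redf Z *+ 2 =
    fps_horner (- l) (falling 'F_p n)^`() * theta (redf f) *+ 2
    + fps_horner (- l) (falling 'F_p n)^`()^`() * theta (- l) * redf f.
Proof.
elim: n => [|n [Z [f_n redZ]]].
  exists 0; rewrite !falling0 !rmorph1 mul1r mul0rn addr0; split=> //.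
  by rewrite -polyC1 derivC deriv0 !rmorph0 !mul0r !mul0rn addr0.
exists (theta (fps_horner (- L) (falling R n) * f) + theta Z *+ p
        + (- L - n%:R) * Z); split.
  rewrite /= f_n /pD raddfD raddfMn /= !fallingS rmorphM /= fps_hornerXsubC.
  by rewrite rmorph_nat; ring.
rewrite !rmorphD rmorphM rmorphMn /= !map_theta rmorphM /= map_fps_horner.
rewrite map_falling rmorphB !rmorphN rmorph_nat /= map_pow_series.
rewrite fps_Fp_mulrn addr0 [_ *+ 2]mulrnDl -(mulrnAr (- l - _)) redZ.
rewrite fallingS derivM derivB derivX derivC subr0 mulr1.
rewrite derivD derivM derivB derivX derivC subr0 mulr1.
rewrite !rmorphD !rmorphM /= fps_hornerXsubC rmorph_nat.
rewrite thetaM theta_horner; ring.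
Qed.

(** Modulo p the falling factorial is T^p - T, with derivative -1 and second
    derivative 0; thus the expansion reads F(-L) U_0 - p theta U_0 = X U_0 modulo
    p^2, and p can be divided out. *)
Lemma theta_residue_part0 (H : fps R) :
  fps_horner (- L) (falling R p) = fpsX + H *+ p -> theta G = redf H * G.
Proof.
move=> falling_L; have [Z [T_p redZ]] := falling_pD_expand (residue_part p 0 U) p.
have HZ : H * residue_part p 0 U = - Z.
  apply: (@fps_tf p) => //; apply/eqP; rewrite mulNrn -addr_eq0 -mulrnAl.
  rewrite -(inj_eq (addrI (fpsX * residue_part p 0 U))) addrA -mulrDl.
  by rewrite -falling_L -T_p falling_pD_p addr0.
rewrite -rmorphM HZ rmorphN /=; apply/eqP; rewrite -addr_eq0; apply/eqP.
move: redZ; rewrite falling_Fp // derivB derivXn derivX.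
rewrite -[_ *+ p]mulr_natr -polyC_natr (pcharf0 (pchar_Fp p_pr)) mulr0 sub0r.
rewrite derivN -polyC1 derivC oppr0 rmorph0 !mul0r addr0 rmorphN rmorph1 mulN1r.
rewrite mulNrn => /eqP; rewrite -addr_eq0 -mulrnDl => /eqP Z2.
apply: fpsP => n; apply/eqP; have := congr1 (fun f : fps 'F_p => f n) Z2.
rewrite coef_fpsMn coef_fps0 addrC -mulr_natr => /eqP; rewrite mulf_eq0.
(* p is odd *)
have /negPf-> // : 2%:R != 0 :> 'F_p; last by rewrite orbF.
by rewrite -(dvdn_pcharf (pchar_Fp p_pr)) gtnNdvd // odd_prime_gt2.
Qed.

(** ** The product G(X) G(-X) *)

(** The exponents of L are odd, so the logarithmic derivatives of U(X) and of
    U(-X) cancel. *)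
Lemma alt_mul : U * alt U = 1.
Proof.
apply: (theta_unique (a := 0)) => //; rewrite ?mul0r ?theta1 //.
- exact: coef_fps0.
- rewrite thetaM theta_scaleX U_ode rmorphM /= pow_series_odd //; ring.
- by rewrite coef0_fpsM coef_scaleX U0 expr0 !mulr1 coef_fps1.
Qed.

(** Modulo p the derivation disappears from pD. *)
Lemma residue_part_red i : (i.+1 < p)%N -> A i = (i.+1%:R - l) * A i.+1.
Proof.
move=> lt_ip; rewrite -(residue_part_ode lt_ip) rmorphD rmorphMn /=.
rewrite /pD rmorphB rmorphMn /= fps_Fp_mulrn rmorphM /= map_pow_series.
by ring.
Qed.

Lemma residue_part_red_prod i : (i < p)%N ->
  A i = A p.-1 * \prod_(i.+1 <= m < p) (m%:R - l).
Proof.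
move=> lt_ip; have [n] := ubnP (p - i); elim: n i lt_ip => // n IHn i lt_ip le_n.
have [le_pi|lt_i1p] := leqP p i.+1.
  by rewrite big_geq // mulr1; congr (A _); lia.
rewrite big_ltn // residue_part_red // (IHn i.+1) //; last by lia.
by rewrite mulrCA.
Qed.

Local Notation D := (\prod_(1 <= m < p) (m%:R - l)).

Lemma prod_natB_X : \prod_(1 <= m < p) (m%:R%:P - 'X) = 'X^(p.-1) - 1 :> {poly 'F_p}.
Proof.
have sgn_p : (-1) ^+ p.-1 = 1 :> {poly 'F_p}.
  by rewrite -signr_odd; case: p p_odd => // n /= /negPf->.
apply: (mulfI (negbT (polyX_eq0 'F_p))).
rewrite mulrBr mulr1 -exprS prednK // -falling_Fp //.
rewrite -[p in falling _ p](prednK p_gt0) /falling big_ord_recl subr0.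
congr (_ * _); rewrite big_add1 big_mkord.
rewrite (eq_bigr (fun i : 'I_p.-1 => -1 * ('X - i.+1%:R%:P))) => [|i _].
  by rewrite big_split prodr_const card_ord sgn_p /= mul1r.
by rewrite mulN1r opprB.
Qed.

Lemma prod_natB_l : D = l ^+ p.-1 - 1.
Proof.
have := congr1 (fps_horner l) prod_natB_X.
rewrite rmorphB rmorphXn rmorph1 rmorph_prod /= fps_hornerX => <-.
apply: eq_bigr => m _.
by rewrite rmorphB /= fps_hornerC fps_hornerX rmorph_nat.
Qed.

Lemma X_factor : fpsX = - l * D.
Proof.
rewrite prod_natB_l mulNr mulrBr -exprS prednK // mulr1 opprB.
by rewrite {1}pow_series_Frobenius // addrK.
Qed.

(** This is the derivative of (1 - X) ... (p - 1 - X) = X^(p-1) - 1, up to sign. *)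
Lemma sum_prod_omit :
  \sum_(1 <= i < p) (\prod_(1 <= m < i) (m%:R - l) *
                     \prod_(i.+1 <= m < p) (m%:R - l)) = l ^+ p.-2.
Proof.
have := congr1 (fun P => fps_horner l P^`()) prod_natB_X.
rewrite deriv_prod_nat derivB derivXn -polyC1 derivC subr0.
have -> : 'X^(p.-2) *+ p.-1 = - 'X^(p.-2) :> {poly 'F_p}.
  apply/eqP; rewrite -addr_eq0 -mulrSr prednK // -mulr_natr -polyC_natr.
  by rewrite (pcharf0 (pchar_Fp p_pr)) mulr0.
rewrite rmorph_sum rmorphN rmorphXn /= fps_hornerX => /(congr1 -%R).
rewrite opprK => <-; rewrite -sumrN; apply: eq_bigr => i _.
rewrite derivB derivC derivX sub0r mulN1r rmorphN opprK rmorphM !rmorph_prod.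
by congr (_ * _); apply: eq_bigr => m _;
  rewrite rmorphB /= fps_hornerC fps_hornerX rmorph_nat.
Qed.

Lemma alt_pow_series : alt l = - l.
Proof. exact: (pow_series_odd 'F_p p_odd). Qed.

Lemma residue_part_alt i : (i < p)%N ->
  residue_part p i (alt (redf U)) = (-1) ^+ i * alt (A i).
Proof.
move=> lt_ip; apply: fpsP => n.
rewrite -(rmorph_sign (@fpsC _)) coef_fpsCM coef_residue_part !coef_scaleX.
rewrite mulrA; congr (_ * _); rewrite -exprD -signr_odd -[RHS]signr_odd.
by rewrite !oddD oddM p_odd andbT addbC.
Qed.

Lemma alt_prod_natB a b :
  alt (\prod_(a <= m < b) (m%:R - l)) = \prod_(a <= m < b) (m%:R + l).
Proof.
rewrite rmorph_prod; apply: eq_bigr => m _.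
by rewrite rmorphB rmorph_nat /= alt_pow_series opprK.
Qed.

(** Modulo p, replace m by p - m. *)
Lemma prod_natD_rev i : (0 < i <= p)%N ->
  \prod_((p - i).+1 <= m < p) (m%:R + l) =
  (-1) ^+ i.-1 * \prod_(1 <= m < i) (m%:R - l).
Proof.
case: i => [//|i]; elim: i => [_|i IHi lt_ip].
  by rewrite subn1 prednK // !big_geq // expr0 mulr1.
rewrite big_ltn; last by lia.
rewrite subnSK // IHi; last by lia.
rewrite [in RHS]big_nat_recr //= exprS natrB; last by lia.
rewrite fps_Fp_mulrn; ring.
Qed.

(** In the terms of U(X) U(-X) = 1 of degree divisible by p, residue i of the
    first factor meets residue p - i of the second.  Expressed with the residue
    part B of index p - 1, this product is B(X) B(-X) times all m - l with m != i,
    and the sum over i is a derivative. *)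
Lemma residue_part0_alt_mul : G * alt G = 1 - l ^+ p.-1.
Proof.
pose B := A p.-1; pose beta := B * alt B.
have altD : alt D = D.
  rewrite prod_natB_l rmorphB rmorphXn rmorph1 /= alt_pow_series exprNn.
  have -> : (-1) ^+ p.-1 = 1 :> fps 'F_p; last by rewrite mul1r.
  by rewrite -signr_odd; case: p p_odd => // n /= /negPf->.
have G_D : G = B * D by rewrite residue_part_red_prod.
have altG_D : alt G = alt B * D by rewrite G_D rmorphM /= altD.
have := congr1 (fun f => residue_part p 0 (redf f)) alt_mul.
rewrite rmorph1 rmorphM /= map_scaleX rmorphN1.
rewrite {1}(residue_part_decomp p_gt0 (redf U)) mulr_suml raddf_sum /=.
rewrite -(big_mkord xpredT (fun i =>
  residue_part p 0 (fpsX ^+ i * dilate p (residue_part p i (redf U)) * alt (redf U)))).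
rewrite big_ltn // expr0 mul1r residue_part_dilateM //.
rewrite residue_part_alt // expr0 mul1r -!map_residue_part.
rewrite [X in _ + X](_ : _ = fpsX * (beta * l ^+ p.-2)); last first.
  rewrite -sum_prod_omit !mulr_sumr; apply: eq_big_nat => i lt_ip.
  rewrite mulrAC mulrC residue_part_dilateM // residue_part0_XnM //; last by lia.
  rewrite residue_part_alt; last by lia.
  rewrite -map_residue_part (@residue_part_red_prod i); last by lia.
  rewrite (@residue_part_red_prod (p - i)); last by lia.
  rewrite rmorphM /= alt_prod_natB.
  rewrite prod_natD_rev; last by lia.
  have sgn_i (f : fps 'F_p) : (-1) ^+ (p - i) * (-1) ^+ i.-1 * f = f.
    by rewrite -exprD -signr_odd (_ : odd _ = false) ?mul1r //; lia.
  rewrite -/B -[RHS]sgn_i /beta; ring.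
have residue_part1 : residue_part p 0 1 = 1 :> fps 'F_p.
  apply: fpsP => n; rewrite coef_residue_part !coef_fps1 addn0 muln_eq0.
  by rewrite (gtn_eqF p_gt0) orbF.
rewrite residue_part1 X_factor altG_D G_D prod_natB_l.
have -> : l ^+ p.-1 = l * l ^+ p.-2.
  by rewrite -exprS prednK // -ltnS prednK.
set e := l * _; set d := e - 1 => eq1.
have : - (beta * d) = 1 by rewrite -eq1 /beta /d /e; ring.
rewrite -[1 - e]opprB -/d => /(congr1 ( *%R (- d))); rewrite mulr1 => <-.
by rewrite /beta; ring.
Qed.

End ArtinHasse.

(** * The p-divided coefficients of the falling factorial *)

Section BinomialsModp.
Variable p : nat.
Hypothesis p_pr : prime p.
Let p_gt0 : (0 < p)%N := prime_gt0 p_pr.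

Lemma Fp_p0 : p%:R = 0 :> 'F_p. Proof. exact: pcharf0 (pchar_Fp p_pr). Qed.

Lemma Fp_natr_neq0 n : (0 < n < p)%N -> n%:R != 0 :> 'F_p.
Proof.
case/andP=> n_gt0 lt_np.
by rewrite -(dvdn_pcharf (pchar_Fp p_pr)) gtnNdvd.
Qed.

Lemma Fp_natrB n : (n <= p)%N -> (p - n)%:R = - n%:R :> 'F_p.
Proof. by move=> le_np; rewrite natrB // Fp_p0 sub0r. Qed.

Lemma Fp_fact_neq0 m : (m < p)%N -> m`!%:R != 0 :> 'F_p.
Proof.
move=> lt_mp; rewrite -(dvdn_pcharf (pchar_Fp p_pr)) fact_prod.
rewrite Euclid_dvd_prod // big_has -all_predC; apply/allP => i.
rewrite mem_index_iota => /andP[i_gt0 le_im] /=.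
by rewrite gtnNdvd // (leq_ltn_trans _ lt_mp).
Qed.

(** Upper negation, since p - 1 - i is -(i + 1) modulo p. *)
Lemma Fp_bin_negate i m : (i + m < p)%N ->
  'C(p.-1 - i, m)%:R = (-1) ^+ m * 'C(i + m, m)%:R :> 'F_p.
Proof.
move=> lt_p; apply: (mulIf (@Fp_fact_neq0 m _)); first by lia.
rewrite -mulrA -!natrM !bin_ffact.
elim: m lt_p => [|m IHm] lt_p; first by rewrite !ffactn0 mulr1.
rewrite ffactnSr natrM IHm; last by lia.
rewrite addnS ffactSS exprS natrM.
have -> : (p.-1 - i - m = p - (i + m).+1)%N by lia.
rewrite Fp_natrB; last by lia.
ring.
Qed.

Lemma Fp_bin_div t : (0 < t < p)%N ->
  ('C(p, t) %/ p)%N%:R = (-1) ^+ t.-1 / t%:R :> 'F_p.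
Proof.
move=> /andP[t_gt0 lt_tp]; apply: (canRL (mulfK _)); first exact/Fp_natr_neq0/andP.
rewrite -natrM divn_mulAC ?prime_dvd_bin ?t_gt0 // mulnC.
rewrite -[p in 'C(p, t)](prednK p_gt0) -[t in 'C(_, t)](prednK t_gt0).
rewrite -{1}(prednK t_gt0) -mul_bin_diag (prednK p_gt0) mulKn //.
rewrite -[p.-1]subn0 Fp_bin_negate ?add0n ?binn ?mulr1 //; lia.
Qed.

Lemma harmonic_p_sum : odd p -> \sum_(1 <= r < p) (r%:R)^-1 = 0 :> 'F_p.
Proof.
move=> p_odd; set h := \sum_(_ <= _ < _) _.
have hN : h = - h.
  (* replace r by p - r *)
  rewrite {1}/h big_nat_rev -sumrN [LHS]big_nat [RHS]big_nat.
  apply: eq_bigr => r /andP[r_gt0 lt_rp].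
  rewrite add1n subSS Fp_natrB ?invrN //; exact: ltnW.
have: h * 2%:R = 0 by rewrite mulr_natr mulr2n {2}hN subrr.
move/eqP; rewrite mulf_eq0 => /orP[/eqP //|].
by rewrite (negPf (@Fp_natr_neq0 2 _)) //= odd_prime_gt2.
Qed.

End BinomialsModp.

Lemma coef_XsubC_expn (R : comNzRingType) (d t : nat) :
  (('X - 1) ^+ d : {poly R})`_t = (-1) ^+ (d - t) * 'C(d, t)%:R.
Proof.
rewrite addrC exprDn coef_sum.
have coefE i : ((-1) ^+ (d - i) * 'X^i *+ 'C(d, i) : {poly R})`_t =
  if i == t then (-1) ^+ (d - t) * 'C(d, t)%:R else 0.
  rewrite -(rmorph_sign (@polyC R)) mul_polyC coefMn coefZ coefXn eq_sym.
  by case: eqP => [->|_]; rewrite ?mulr0 ?mul0rn // mulr1 mulr_natr.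
under eq_bigr do rewrite coefE.
have [lt_td|le_dt] := ltnP t d.+1.
  rewrite (bigD1 (Ordinal lt_td)) //= eqxx big1 ?addr0 // => i.
  by rewrite -val_eqE /= => /negPf->.
rewrite bin_small // mulr0 big1 // => i _.
by rewrite ltn_eqF // (leq_trans _ le_dt).
Qed.

Section DividedFalling.
Variables (p : nat) (R : comNzRingType) (red : {rmorphism R -> 'F_p}).
Hypothesis p_pr : prime p.
Hypothesis p_odd : odd p.
Hypothesis R_tf : forall n (x y : R), (0 < n)%N -> x *+ n = y *+ n -> x = y.
Hypothesis red_ker : forall x, red x = 0 -> exists y, x = y *+ p.

Let p_gt0 : (0 < p)%N := prime_gt0 p_pr.
Let p_gt1 : (1 < p)%N := prime_gt1 p_pr.

Lemma divided_falling_exists : exists Q : {poly R},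
  falling R p = 'X^p - 'X + Q *+ p.
Proof.
pose P := falling R p - ('X^p - 'X).
have red_P : map_poly red P = 0.
  rewrite !rmorphB /= map_falling falling_Fp // map_polyXn map_polyX; ring.
have ker_P n : exists y, P`_n = y *+ p.
  by apply: red_ker; rewrite -coef_map red_P coef0.
have [q Pq] := choice ker_P; exists (\poly_(i < size P) q i).
rewrite -[LHS](subrK ('X^p - 'X)) -/P addrC; congr (_ + _).
apply/polyP => i; rewrite coefMn coef_poly; case: ltnP => [_|le_i] //.
by rewrite mul0rn nth_default.
Qed.

Variable Q : {poly R}.
Hypothesis QE : falling R p = 'X^p - 'X + Q *+ p.

Lemma falling_X n :
  falling R n.+1 = 'X * \prod_(i < n) ('X - i.+1%:R%:P).
Proof. by rewrite /falling big_ord_recl subr0. Qed.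

Lemma coef_divided_falling n :
  Q`_n *+ p = (falling R p)`_n - (n == p)%:R + (n == 1)%:R.
Proof. by rewrite QE !coefE; ring. Qed.

Lemma size_divided_falling : (size Q <= p)%N.
Proof.
apply/leq_sizeP => n le_pn; apply: (R_tf p_gt0); rewrite mul0rn.
rewrite coef_divided_falling (gtn_eqF (leq_trans p_gt1 le_pn)) addr0.
have := le_pn; rewrite leq_eqVlt => /predU1P[<-|lt_pn]; last first.
  by rewrite nth_default ?size_falling // (gtn_eqF lt_pn) subr0.
have /monicP := falling_monic R p; rewrite lead_coefE size_falling /= => ->.
by rewrite eqxx subrr.
Qed.

Lemma divided_falling0 : Q`_0 = 0.
Proof.
apply: (R_tf p_gt0); rewrite mul0rn coef_divided_falling -(prednK p_gt0).
by rewrite falling_X coefXM subr0 addr0.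
Qed.

(** The coefficient of X in X (X - 1) ... (X - p + 1) is (p - 1)!. *)
Lemma divided_falling1 : Q`_1 = (((p.-1)`! + 1) %/ p)%N%:R.
Proof.
apply: (R_tf p_gt0); rewrite coef_divided_falling (ltn_eqF p_gt1) subr0.
rewrite -[RHS]mulr_natr -natrM divnK; last by rewrite addn1 -Wilson.
rewrite natrD -{1}(prednK p_gt0) falling_X coefXM /= -horner_coef0 horner_prod.
congr (_ + 1); rewrite fact_prod big_add1 big_mkord natr_prod.
rewrite (eq_bigr (fun i : 'I_p.-1 => -1 * i.+1%:R)) => [|i _]; last first.
  by rewrite hornerXsubC sub0r mulN1r.
rewrite big_split prodr_const card_ord -signr_odd /=.
have -> : odd p.-1 = false by lia.
by rewrite mul1r.
Qed.

(** The falling factorial F satisfies F(X) - F(X - 1) = p (X - 1) ... (X - p + 1).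
    Divide by p: modulo p the product is X^(p-1) - 1, and the sum comes from the
    binomial coefficients in X^p - (X - 1)^p. *)
Lemma divided_falling_diff :
  map_poly red Q - (map_poly red Q \Po ('X - 1)) =
  'X^(p.-1) - 1 + \sum_(1 <= t < p) (t%:R)^-1 *: 'X^t.
Proof.
pose K : {poly R} := \prod_(i < p.-1) ('X - i.+1%:R%:P).
pose S : {poly R} := \sum_(1 <= i < p) ((-1) ^+ i * ('C(p, i) %/ p)%N%:R) *: 'X^(p - i).
have pE := prednK p_gt0.
have F_X : falling R p = 'X * K by rewrite -[in LHS]pE falling_X.
have F_X1 : falling R p \Po ('X - 1) = K * ('X - p%:R).
  rewrite -[in LHS]pE /falling rmorph_prod big_ord_recr /=.
  rewrite rmorphB /= comp_polyX comp_polyC polyC_natr.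
  rewrite -addrA -opprD -mulrS pE; congr (_ * _).
  apply: eq_bigr => i _.
  by rewrite rmorphB /= comp_polyX comp_polyC -addrA -opprD -polyC1 -polyCD -mulrS.
have X1_p : ('X - 1) ^+ p = 'X^p - 1 + S *+ p :> {poly R}.
  rewrite exprBn -(big_mkord xpredT (fun i => ((-1) ^+ i * 'X^(p - i) * 1 ^+ i) *+ 'C(p, i))).
  rewrite big_nat_recr //= big_ltn // bin0 binn subn0 subnn !expr1n !expr0 !mulr1 !mul1r !mulr1n.
  rewrite -signr_odd p_odd expr1 addrAC; congr (_ + _ + _).
  rewrite /S -sumrMnl; apply: eq_big_nat => i lt_ip.
  rewrite expr1n mulr1 -{1}(divnK (prime_dvd_bin p_pr lt_ip)) mulrnA.
  by rewrite -mul_polyC rmorphM rmorph_sign /= polyC_natr mulrAC mulr_natr.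
have diff_Q : Q - (Q \Po ('X - 1)) = K + S.
  have : falling R p - (falling R p \Po ('X - 1)) = K *+ p.
    by rewrite F_X1 F_X -mulr_natr; ring.
  rewrite QE rmorphD rmorphB rmorphMn rmorphXn /= comp_polyX X1_p => diff_p.
  apply/polyP => n; apply: (R_tf p_gt0); rewrite -!coefMn; congr (_`_n).
  rewrite [in RHS]mulrnDl -diff_p; congr polyseq; ring.
rewrite -[_ \Po ('X - 1)](_ : map_poly red (Q \Po ('X - 1)) = _); last first.
  by rewrite map_comp_poly rmorphB /= map_polyX rmorph1.
rewrite -rmorphB diff_Q rmorphD; congr (_ + _).
  apply: (mulfI (negbT (polyX_eq0 'F_p))).
  rewrite -[X in X * _ = _](map_polyX red) -rmorphM /= -F_X map_falling falling_Fp //.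
  by rewrite mulrBr mulr1 -exprS pE.
rewrite rmorph_sum big_nat_rev [LHS]big_nat [RHS]big_nat.
apply: eq_bigr => i /andP[i_gt0 lt_ip]; rewrite add1n subSS subKn ?(ltnW lt_ip) //.
rewrite /= map_polyZ map_polyXn rmorphM rmorph_sign rmorph_nat Fp_bin_div //; last by lia.
rewrite mulrA -exprD Fp_natrB ?(ltnW lt_ip) // invrN -signr_odd.
have -> : odd (p - i + (p - i).-1) by lia.
by rewrite expr1 mulN1r opprK.
Qed.

(** The coefficient of X^t in the difference equation is a relation between the
    coefficients of Q of index greater than t.  With n = p - t and b_i = (p - i)
    times the coefficient of index p - i, it becomes the Bernoulli recurrence for
    n, because binomial coefficients with upper index p - 1 - i are, up to sign,
    binomial coefficients with upper index n.  Such a recurrence determines b. *)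
Lemma divided_falling_bernoulli (beta : nat -> 'F_p) d : beta 0 = 1 ->
    (forall n, (1 < n < p)%N -> \sum_(i < n) 'C(n, i)%:R * beta i = 0) ->
  (1 < d < p)%N -> red Q`_d = beta (p - d)%N / d%:R.
Proof.
move=> beta0 betaE.
pose q n := red Q`_n; pose b i := (p - i)%:R * q (p - i)%N.
have bE n : (1 < n < p)%N -> \sum_(1 <= i < n) 'C(n, i)%:R * b i = -1.
  move=> lt_np; pose t := (p - n)%N; have t_gt0 : (0 < t < p)%N by lia.
  have := congr1 (fun P : {poly 'F_p} => P`_t) divided_falling_diff.
  have lt_t : (t < p.-1)%N by lia.
  have -> : map_poly red Q = \sum_(0 <= d < p) q d *: 'X^d.
    rewrite big_mkord -poly_def; apply/polyP => m; rewrite coef_map coef_poly.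
    case: ltnP => // le_pm; rewrite nth_default; first exact: rmorph0.
    exact: leq_trans size_divided_falling le_pm.
  rewrite rmorph_sum /= -sumrB (big_cat_nat (n := t.+1)) //=; last by lia.
  rewrite coefD.
  have -> : (\sum_(0 <= e < t.+1) (q e *: 'X^e - (q e *: 'X^e \Po ('X - 1))))`_t = 0.
    rewrite coef_sum big_nat big1 // => e /=; rewrite ltnS leq_eqVlt => le_et.
    rewrite linearZ /= rmorphXn /= comp_polyX coefB !coefZ coefXn coef_XsubC_expn.
    case/predU1P: le_et => [->|lt_et].
      by rewrite eqxx subnn expr0 binn !mulr1 subrr.
    by rewrite (gtn_eqF lt_et) bin_small // !mulr0 subrr.
  have -> : ('X^(p.-1) - 1 + \sum_(1 <= m < p) (m%:R)^-1 *: 'X^m)`_t = (t%:R)^-1 :> 'F_p.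
    rewrite coefD coefB coefXn coef1 (ltn_eqF lt_t) coef_sum.
    have -> : (t == 0) = false by lia.
    rewrite subr0 add0r (bigD1_seq t) ?iota_uniq ?mem_index_iota //=.
    rewrite coefZ coefXn eqxx mulr1 big1 ?addr0 // => m ne_mt.
    by rewrite coefZ coefXn eq_sym (negPf ne_mt) mulr0.
  rewrite add0r coef_sum => /(congr1 ( *%R (- t%:R))); rewrite [RHS]mulNr mulfV; last first.
    exact: Fp_natr_neq0.
  move<-; rewrite big_nat_rev -[t.+1]add1n [in RHS]big_addn mulr_sumr.
  have -> : (p - t = n)%N by lia.
  rewrite [LHS]big_nat [RHS]big_nat; apply: eq_bigr => i lt_in.
  have -> : (1 + n - i.+1 = n - i)%N by [].
  have -> : (i + t = p - (n - i))%N by rewrite /t; lia.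
  rewrite linearZ /= rmorphXn /= comp_polyX coefB !coefZ coefXn coef_XsubC_expn.
  have -> : (t == p - (n - i))%N = false by rewrite /t; lia.
  have -> : (p - (n - i) - t = i)%N by rewrite /t; lia.
  have tC : t%:R * 'C(p - (n - i), t)%:R =
      (p - (n - i))%:R * ((-1) ^+ i * 'C(n, n - i)%:R) :> 'F_p.
    have [t_gt0' e_gt0] : (0 < t)%N /\ (0 < p - (n - i))%N by rewrite /t; lia.
    rewrite -natrM -{1}(prednK t_gt0') -{2}(prednK t_gt0') -mul_bin_diag natrM.
    congr (_ * _).
    have -> : (p - (n - i)).-1 = (p.-1 - (n - i))%N by lia.
    rewrite -bin_sub; last by rewrite /t; lia.
    have -> : (p.-1 - (n - i) - t.-1 = i)%N by rewrite /t; lia.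
    rewrite Fp_bin_negate //; last by lia.
    rewrite subnK; last by lia.
    by rewrite bin_sub //; lia.
  have sgn_sq (x : 'F_p) : (-1) ^+ i * (-1) ^+ i * x = x.
    by rewrite -expr2 sqrr_sign mul1r.
  rewrite -[LHS]sgn_sq /b mulr0n mulr0 sub0r mulNr mulrN opprK [RHS]mulrCA [t%:R * _]mulrCA tC.
  by ring.
have b_beta i : (0 < i < p.-1)%N -> b i = beta i.
  elim/ltn_ind: i => i IHi lt_ip.
  have := betaE i.+1; have := bE i.+1.
  rewrite -(big_mkord xpredT (fun j => 'C(i.+1, j)%:R * beta j)).
  rewrite [in X in _ -> X]big_nat_recr // [X in _ -> (_ -> X + _ = _) -> _]big_ltn; last by lia.
  rewrite big_nat_recr /=; last by lia.
  rewrite bin0 beta0 mulr1 binSn => sum_b sum_beta.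
  have i1_neq0 : i.+1%:R != 0 :> 'F_p by apply: Fp_natr_neq0 => //; lia.
  apply: (mulfI i1_neq0); apply: (addrI (1 + \sum_(1 <= j < i) 'C(i.+1, j)%:R * beta j)).
  rewrite sum_beta; last by lia.
  rewrite -addrA -[X in 1 + (X + _)](_ : \sum_(1 <= j < i) 'C(i.+1, j)%:R * b j = _).
    by rewrite sum_b ?subrr //; lia.
  rewrite big_nat [RHS]big_nat; apply: eq_bigr => j lt_ji.
  by rewrite IHi //; lia.
move=> lt_dp; apply: (canRL (mulfK _)); first by apply: Fp_natr_neq0 => //; lia.
rewrite -b_beta; last by lia.
rewrite /b subKn; first exact: mulrC.
by lia.
Qed.

End DividedFalling.

(** * The coefficients of theta(G(-X)) G(X) *)

Lemma scaleX_horner (R : comNzRingType) (c : R) f P :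
  scaleX c (fps_horner f P) = fps_horner (scaleX c f) P.
Proof.
elim/poly_ind: P => [|P a IHP]; first by rewrite !rmorph0.
rewrite !rmorphD !rmorphM /= !fps_hornerX !fps_hornerC IHP; congr (_ + _).
apply: fpsP => n; rewrite coef_scaleX /= coefC.
by case: n => [|n]; rewrite ?mul1r ?mulr0.
Qed.

Lemma digits_uniq m d e j i : (0 < d <= m)%N -> (0 < e <= m)%N ->
  (d + j * m == e + i * m)%N = (d == e) && (j == i).
Proof.
move=> /andP[d_gt0 le_dm] /andP[e_gt0 le_em]; apply/eqP/andP=> [eq_de|[/eqP-> /eqP->] //].
have m_gt0 : (0 < m)%N := leq_trans d_gt0 le_dm.
have {}eq_de : (j * m + d.-1 = i * m + e.-1)%N by lia.
have := congr1 (modn^~ m) eq_de; have := congr1 (divn^~ m) eq_de.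
rewrite !divnMDl // !modnMDl !divn_small ?modn_small; lia.
Qed.

Section CShift.
Variable p : nat.
Hypothesis p_pr : prime p.
Hypothesis p_odd : odd p.

Lemma c0 : c p 0 = 0. Proof. by []. Qed.
Lemma c1 : c p 1 = 0. Proof. by []. Qed.

(** The closed formula remains true for j = 1, where the harmonic sum is empty,
    and for j = p, where it is the sum of all nonzero elements of F_p. *)
Lemma cE j : (0 < j <= p)%N -> c p j = (-1) ^+ j * harmonic_modp p j.-1.
Proof.
case/andP=> j_gt0 le_jp; have p_gt2 := odd_prime_gt2 p_odd p_pr.
rewrite /c; case: ifP => [/andP[le2j _]|j_range].
  by rewrite subn1 -signr_odd oddB // addbF signr_odd.
have [->|->] : j = 1%N \/ j = p by lia.
  by rewrite /harmonic_modp big_geq // mulr0.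
by rewrite /harmonic_modp prednK ?prime_gt0 // harmonic_p_sum // mulr0.
Qed.

Lemma cp : c p p = 0.
Proof. by rewrite /c [(p <= _)%N]leqNgt prednK ?prime_gt0 // leqnn andbF. Qed.

Lemma c_rec j : (0 < j < p)%N -> c p j.+1 + c p j = (-1) ^+ j.-1 / j%:R.
Proof.
move=> lt_jp; rewrite !cE; try lia.
rewrite /harmonic_modp -[j.+1.-1]/j big_nat_recr /=; last by lia.
have -> : j = j.-1.+1 by lia.
rewrite /= !exprS; ring.
Qed.

End CShift.

Section Assembly.
Variables (p : nat) (R : comNzRingType) (red : {rmorphism R -> 'F_p}).
Hypothesis p_pr : prime p.
Hypothesis p_odd : odd p.
Hypothesis R_tf : forall n (x y : R), (0 < n)%N -> x *+ n = y *+ n -> x = y.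
Hypothesis red_ker : forall x, red x = 0 -> exists y, x = y *+ p.

Let p_gt0 : (0 < p)%N := prime_gt0 p_pr.
Let p_gt1 : (1 < p)%N := prime_gt1 p_pr.
Local Notation redf := (map_fps red).
Local Notation alt := (scaleX (-1)).
Local Notation L := (pow_series R p).
Local Notation l := (pow_series 'F_p p).
Local Notation E := (1 - l ^+ p.-1).

Lemma pow_seriesM_E : l * E = fpsX.
Proof.
rewrite mulrBr mulr1 -exprS prednK //.
by rewrite {1}pow_series_Frobenius // addrK.
Qed.

(** Divide l (1 - l^(p-1)) = X by X, where l = X (1 + X^(p-1)) up to degree p^2. *)
Lemma XM_E_upto : eq_upto (p ^ 2 - 1) ((1 + fpsX ^+ p.-1) * E) 1.
Proof.
apply/(eq_upto_mulX _ 1); rewrite subnKC ?expn_gt0 ?p_gt0 // mulr1 expr1.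
rewrite -[X in eq_upto _ _ X]pow_seriesM_E mulrA [fpsX * _]mulrDr mulr1 -exprS prednK //.
exact: eq_uptoM (eq_upto_sym (pow_series_upto _ p_pr)) (eq_upto_refl _).
Qed.

(** One factor l is turned into X by l (1 - l^(p-1)) = X. *)
Lemma pow_seriesX_E_upto d : (0 < d)%N ->
  eq_upto (p ^ 2) (l ^+ d * E)
    (\sum_(j < d) fpsX ^+ (d + j * p.-1) *+ 'C(d.-1, j)).
Proof.
move=> d_gt0; rewrite -{1}(prednK d_gt0) exprSr -mulrA pow_seriesM_E.
apply: (eq_upto_trans (g := (fpsX + fpsX ^+ p) ^+ d.-1 * fpsX)).
  apply: eq_uptoM (eq_upto_refl _).
  exact: eq_uptoX (pow_series_upto _ p_pr).
rewrite exprDn mulr_suml prednK //.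
move=> n _; congr (fps_coef _ n); apply: eq_bigr => j _.
rewrite mulrnAl -exprM -exprD -exprSr; congr (_ ^+ _ *+ _).
have := ltn_ord j; case: p p_gt0 => // q _ /=; lia.
Qed.

(** Divisibility by p is the Frobenius identity for l.  The coefficients come
    from the binomial expansion of (X + X^p)^p, whose first term cancels against
    X - L and whose last term has degree p^2. *)
Lemma remainder_exists : exists rho : fps R,
  L ^+ p - L + fpsX = rho *+ p /\
  eq_upto (p ^ 2) (redf rho)
    (\sum_(1 <= t < p) fpsC ((-1) ^+ t.-1 / t%:R) * fpsX ^+ (p + t * p.-1)).
Proof.
have [rho rhoE] : exists rho : fps R, L ^+ p - L + fpsX = rho *+ p.
  apply: (fps_red_ker red_ker); rewrite rmorphD rmorphB rmorphXn /= map_pow_series.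
  by rewrite map_fpsX {2}pow_series_Frobenius //; ring.
exists rho; split=> //.
pose S : fps R := \sum_(1 <= t < p) fpsX ^+ (p + t * p.-1) *+ ('C(p, t) %/ p).
suff rhoS : eq_upto (p ^ 2) rho S.
  move=> n lt_n; rewrite coef_map_fps rhoS // -coef_map_fps; congr (fps_coef _ n).
  rewrite rmorph_sum; apply: eq_big_nat => t lt_tp.
  rewrite rmorphMn rmorphXn /= map_fpsX -mulr_natl -(rmorph_nat (@fpsC _)).
  by rewrite Fp_bin_div.
move=> n lt_n; apply: (R_tf p_gt0); rewrite -!coef_fpsMn -rhoE.
have Lp := eq_uptoX p (pow_series_upto R p_pr).
rewrite !coef_fpsD coef_fpsN Lp // (pow_series_upto R p_pr lt_n).
rewrite -coef_fpsN -!coef_fpsD.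
have -> : (fpsX + fpsX ^+ p) ^+ p - (fpsX + fpsX ^+ p) + fpsX
    = S *+ p + fpsX ^+ (p ^ 2) :> fps R.
  rewrite exprDn -(big_mkord xpredT
    (fun i => fpsX ^+ (p - i) * (fpsX ^+ p) ^+ i *+ 'C(p, i))).
  rewrite big_nat_recr //= big_ltn // bin0 binn subn0 subnn.
  rewrite expr0 mulr1 mul1r !mulr1n -exprM mulnn.
  have -> : \sum_(1 <= i < p) fpsX ^+ (p - i) * (fpsX ^+ p) ^+ i *+ 'C(p, i)
      = S *+ p :> fps R.
    rewrite /S -sumrMnl; apply: eq_big_nat => t lt_tp.
    rewrite -mulrnA divnK ?prime_dvd_bin // -exprM -exprD.
    congr (_ ^+ _ *+ _).
    by case: p p_gt0 lt_tp => // q _ /= lt_tp; lia.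
  by ring.
by rewrite coef_fpsD coef_fpsXn (ltn_eqF lt_n) addr0.
Qed.

(** By its recurrence, the generating series of the c_j multiplied by 1 + X^(p-1)
    is the given sum; and 1 - l^(p-1) is the inverse of 1 + X^(p-1). *)
Lemma remainder_E_upto (rho : fps 'F_p) :
  eq_upto (p ^ 2) rho
    (\sum_(1 <= t < p) fpsC ((-1) ^+ t.-1 / t%:R) * fpsX ^+ (p + t * p.-1)) ->
  eq_upto (p ^ 2 - 1) (rho * E)
    (\sum_(0 <= j < p.+1) fpsC (c p j) * fpsX ^+ (1 + j * p.-1)).
Proof.
set cX := \sum_(0 <= j < p.+1) _ => rhoE.
have sumE : \sum_(1 <= t < p) fpsC ((-1) ^+ t.-1 / t%:R) * fpsX ^+ (p + t * p.-1)
    = cX * (1 + fpsX ^+ p.-1).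
  have shiftl : cX = \sum_(0 <= j < p) fpsC (c p j.+1) * fpsX ^+ (1 + j.+1 * p.-1).
    by rewrite /cX big_ltn // c0 rmorph0 mul0r add0r big_add1.
  have shiftr : cX * fpsX ^+ p.-1 =
      \sum_(0 <= j < p) fpsC (c p j) * fpsX ^+ (1 + j.+1 * p.-1).
    rewrite /cX mulr_suml big_nat_recr // cp // rmorph0 !mul0r /= addr0.
    apply: eq_bigr => j _; rewrite -mulrA -exprD; congr (_ * _ ^+ _).
    by rewrite mulSn addnAC addnA.
  rewrite mulrDr mulr1 {1}shiftl shiftr -big_split /= [RHS]big_ltn //.
  rewrite c1 c0 rmorph0 mul0r addr0 add0r; apply: eq_big_nat => j lt_jp.
  rewrite -c_rec // rmorphD mulrDl.
  by congr (_ * _ ^+ _ + _ * _ ^+ _); case: p p_gt0 => // q _ /=; lia.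
have le_p2 : (p ^ 2 - 1 <= p ^ 2)%N := leq_subr _ _.
apply: (eq_upto_trans (g := cX * ((1 + fpsX ^+ p.-1) * E))).
  by rewrite mulrA -sumE; apply: eq_uptoM (eq_uptoW le_p2 rhoE) (eq_upto_refl _).
rewrite -[X in eq_upto _ _ X]mulr1.
exact: eq_uptoM (eq_upto_refl _) XM_E_upto.
Qed.

Variable Q : {poly R}.
Hypothesis QE : falling R p = 'X^p - 'X + Q *+ p.

Lemma horner_E_coef d j : (0 < d < p)%N -> (d + j * p.-1 < p ^ 2 - 1)%N ->
  (fps_horner l (map_poly red Q) * E) (d + j * p.-1)%N
  = 'C(d.-1, j)%:R * red Q`_d.
Proof.
move=> lt_dp; set k := (d + _)%N => lt_k.
have -> : map_poly red Q = \poly_(e < p) red Q`_e.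
  apply/polyP => m; rewrite coef_map coef_poly.
  case: ltnP => // le_pm; rewrite nth_default; first exact: rmorph0.
  exact: leq_trans (size_divided_falling p_pr R_tf QE) le_pm.
rewrite poly_def -(big_mkord xpredT (fun e => red Q`_e *: 'X^e)).
rewrite rmorph_sum mulr_suml coef_fps_sum.
have termE e : (0 < e < p)%N ->
  (fps_horner l (red Q`_e *: 'X^e) * E) k =
    if e == d then 'C(d.-1, j)%:R * red Q`_d else 0.
  case/andP=> e_gt0 lt_ep.
  rewrite fps_hornerZXn -mulrA coef_fpsCM.
  rewrite (pow_seriesX_E_upto e_gt0); last by apply: leq_trans lt_k _; apply: leq_subr.
  rewrite coef_fps_sum; under eq_bigr => i _.
    rewrite coef_fpsMn coef_fpsXn digits_uniq; try lia.
    rewrite [d == e]eq_sym; over.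
  case: eqP => [<-|ne_ed]; last first.
    by rewrite big1 ?mulr0 // => i _; rewrite mul0rn.
  rewrite mulrC; congr (_ * _).
  have [lt_je|le_ej] := ltnP j e.
    rewrite (bigD1 (Ordinal lt_je)) //= !eqxx big1 ?addr0 // => i.
    by rewrite -val_eqE /= eq_sym => /negPf->; rewrite mul0rn.
  rewrite bin_small; last by lia.
  rewrite big1 // => i _; rewrite gtn_eqF ?mul0rn //.
  exact: leq_trans (ltn_ord i) le_ej.
rewrite big_ltn // (divided_falling0 p_pr R_tf QE) // rmorph0 scale0r rmorph0 mul0r.
rewrite coef_fps0 add0r (eq_big_nat _ _ termE).
rewrite (bigD1_seq d) ?iota_uniq ?mem_index_iota //= eqxx.
by rewrite big1 ?addr0 // => e /negPf->.
Qed.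

Variable U : fps R.
Hypothesis U0 : U 0 = 1.
Hypothesis U_ode : theta U = pow_series R p * U.

(** The sum is the coefficient of X^k in theta(G(-X)) G(X), a product which is known
    from theta_residue_part0 and residue_part0_alt_mul. *)
Theorem coef_twisted_square d j :
    (0 < d < p)%N -> (d + j * p.-1 < p ^ 2 - 1)%N ->
  let k := (d + j * p.-1)%N in
  \sum_(r < k.+1) (-1) ^+ r * r%:R * red (U (r * p)%N) * red (U ((k - r) * p)%N)
  = 'C(d.-1, j)%:R * red Q`_d + (d == 1%N)%:R * c p j.
Proof.
move=> lt_dp lt_k k.
have [rho [rhoE redrho]] := remainder_exists.
(* H plays the role of h(-X) *)
pose H := fps_horner L Q + rho; pose G := redf (residue_part p 0 U).
have HE : fps_horner L (falling R p) + fpsX = H *+ p.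
  rewrite QE rmorphD rmorphB rmorphXn rmorphMn /= fps_hornerX mulrnDl -rhoE.
  by ring.
have thetaG : theta G = alt (redf H) * G.
  rewrite -[-1](rmorphN1 red) -map_scaleX.
  apply: (theta_residue_part0 red p_pr p_odd R_tf U_ode).
  have := congr1 alt HE; rewrite rmorphD rmorphMn /= scaleX_horner.
  rewrite pow_series_odd // scaleXX rmorphN1 mulN1r => <-.
  by rewrite addrCA subrr addr0.
have altK f : alt (alt f) = f :> fps 'F_p.
  apply: fpsP => n; rewrite !coef_scaleX mulrA -exprD -signr_odd addnn odd_double.
  by rewrite mul1r.
have -> : \sum_(r < k.+1) (-1) ^+ r * r%:R * red (U (r * p)%N) * red (U ((k - r) * p)%N)
    = (theta (alt G) * G) k.
  rewrite coef_fpsM; apply: eq_bigr => r _.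
  rewrite coef_theta coef_scaleX !coef_map_fps !coef_residue_part !addn0.
  by rewrite -mulr_natr; ring.
have -> : theta (alt G) * G = redf H * E.
  rewrite theta_scaleX thetaG rmorphM /= altK -mulrA [alt G * G]mulrC.
  by rewrite (residue_part0_alt_mul red p_pr p_odd R_tf U0 U_ode).
have -> : redf H = fps_horner l (map_poly red Q) + redf rho.
  by rewrite rmorphD /= map_fps_horner map_pow_series.
rewrite mulrDl coef_fpsD.
rewrite horner_E_coef //; congr (_ + _).
rewrite (remainder_E_upto redrho) // coef_fps_sum.
under eq_bigr => i _.
  rewrite coef_fpsCM coef_fpsXn digits_uniq; try lia.
  over.
have [d1|_] := eqVneq d 1%N; last by rewrite mul0r big1 // => i _; rewrite mulr0.
have lt_jp : (j < p.+1)%N.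
  rewrite -(ltn_pmul2r (_ : 0 < p.-1)%N) ?prednK //; last by rewrite -ltnS prednK.
  by rewrite d1 in lt_k; case: p p_gt0 lt_k => // q _ /=; lia.
rewrite (bigD1_seq j) ?iota_uniq ?mem_index_iota //= eqxx mulr1 mul1r.
by rewrite big1 ?addr0 // => i; rewrite eq_sym => /negPf->; rewrite mulr0.
Qed.

End Assembly.

(** * The ring of p-integral rationals *)

Definition pint (p : nat) : {pred rat} := fun x => coprime p `|denq x|.

Lemma numq_natdiv x : x * (`|denq x|%N)%:R = (numq x)%:~R.
Proof. by rewrite numqE pmulrn absz_denq. Qed.

Lemma numq_frac x (n : int) d : x * d%:R = n%:~R ->
  (numq x * d%:Z = n * `|denq x|%N%:Z)%R.
Proof.
move=> xd; apply: (intr_inj (R := rat)); rewrite !rmorphM /= -numq_natdiv -xd.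
by rewrite -!pmulrn; ring.
Qed.

(** The denominator of an irreducible fraction divides all the others. *)
Lemma pint_frac (p : nat) x (n : int) d :
  coprime p d -> x * d%:R = n%:~R -> x \in pint p.
Proof.
move=> co_pd /numq_frac /(congr1 absz); rewrite !abszM /= => eq_nd.
apply: coprime_dvdr co_pd; rewrite -(@Gauss_dvdr _ `|numq x|%N).
  by rewrite eq_nd dvdn_mull.
by rewrite coprime_sym coprime_num_den.
Qed.

Fact pint_subring (p : nat) : subring_closed (pint p).
Proof.
split=> [|x y xp yp|x y xp yp].
- by apply: (@pint_frac p 1 1 1); rewrite ?coprimen1 ?mulr1.
- apply: (@pint_frac p _ (numq x * (`|denq y|%N) - numq y * (`|denq x|%N))
                     (`|denq x| * `|denq y|)%N).
    by rewrite coprimeMr; apply/andP.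
  rewrite natrM rmorphB !rmorphM /= -!numq_natdiv; ring.
apply: (@pint_frac p _ (numq x * numq y) (`|denq x| * `|denq y|)%N).
  by rewrite coprimeMr; apply/andP.
by rewrite natrM rmorphM /= -!numq_natdiv; ring.
Qed.
HB.instance Definition _ p := GRing.isSubringClosed.Build rat (pint p) (pint_subring p).

(** Packed as a ring, so that reduction modulo p is a ring morphism on it. *)
Record zloc (p : nat) := Zloc { zval :> rat; _ : zval \in pint p }.
HB.instance Definition _ p := [isSub for @zval p].
HB.instance Definition _ p := [Choice of zloc p by <:].
HB.instance Definition _ p := [SubChoice_isSubComNzRing of zloc p by <:].

Lemma zvalK p x : x \in pint p -> zval (insubd (0 : zloc p) x) = x.
Proof. exact: insubdK. Qed.

Section ZlocReduction.
Variable p : nat.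
Hypothesis p_pr : prime p.

Lemma coprime_Fp_neq0 d : coprime p d -> d%:R != 0 :> 'F_p.
Proof. by rewrite -(dvdn_pcharf (pchar_Fp p_pr)) prime_coprime. Qed.

Lemma redp_frac x (n : int) d : coprime p d -> x * d%:R = n%:~R ->
  redp p x = n%:~R / d%:R.
Proof.
move=> co_pd xd; have pint_x := pint_frac co_pd xd.
have d_neq0 := coprime_Fp_neq0 co_pd; have x_neq0 := coprime_Fp_neq0 pint_x.
have := congr1 (fun z : int => z%:~R : 'F_p) (numq_frac xd).
rewrite !rmorphM /= -!pmulrn => eq_nd.
rewrite /redp /ratr -[denq x]absz_denq -pmulrn.
by apply/eqP; rewrite eqr_div // eq_nd.
Qed.

Lemma redp_pint x : x \in pint p -> redp p x = (numq x)%:~R / (`|denq x|%N)%:R.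
Proof. by move=> pint_x; rewrite (redp_frac pint_x (numq_natdiv x)). Qed.

(** Taking primality as an argument attaches the morphism structure to zred. *)
Definition zred of prime p := fun x : zloc p => redp p (val x).

Fact zred_zmod : zmod_morphism (zred p_pr).
Proof.
move=> x y; rewrite /zred rmorphB /=.
have px : zval x \in pint p := valP x.
have py : zval y \in pint p := valP y.
rewrite (redp_pint px) (redp_pint py).
rewrite (@redp_frac _ (numq x * (`|denq y|%N) - numq y * (`|denq x|%N))
                    (`|denq x| * `|denq y|)%N).
- have [x_neq0 y_neq0] := (coprime_Fp_neq0 px, coprime_Fp_neq0 py).
  by rewrite natrM rmorphB !rmorphM /=; field; apply/andP.
- by rewrite coprimeMr; apply/andP.
by rewrite natrM rmorphB !rmorphM /= -!numq_natdiv; ring.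
Qed.
Fact zred_monoid : monoid_morphism (zred p_pr).
Proof.
split=> [|x y]; rewrite /zred ?rmorph1 ?rmorphM /=.
  by rewrite (@redp_frac 1 1 1) ?coprimen1 ?mulr1 // divr1.
have px : zval x \in pint p := valP x.
have py : zval y \in pint p := valP y; rewrite (redp_pint px) (redp_pint py).
rewrite (@redp_frac _ (numq x * numq y)
                    (`|denq x| * `|denq y|)%N).
- have [x_neq0 y_neq0] := (coprime_Fp_neq0 px, coprime_Fp_neq0 py).
  by rewrite natrM rmorphM /=; field; apply/andP.
- by rewrite coprimeMr; apply/andP.
by rewrite natrM rmorphM /= -!numq_natdiv; ring.
Qed.
HB.instance Definition _ := GRing.isZmodMorphism.Build _ _ (zred p_pr) zred_zmod.
HB.instance Definition _ := GRing.isMonoidMorphism.Build _ _ (zred p_pr) zred_monoid.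

Lemma zloc_torsion_free n (x y : zloc p) : (0 < n)%N -> x *+ n = y *+ n -> x = y.
Proof.
move=> n_gt0 /(congr1 val); rewrite !rmorphMn /= => eq_n; apply: val_inj.
have n_neq0 : n%:R != 0 :> rat by rewrite pnatr_eq0 -lt0n.
by apply: (mulIf n_neq0); rewrite !mulr_natr.
Qed.

Lemma zred_ker (x : zloc p) : zred p_pr x = 0 -> exists y, x = y *+ p.
Proof.
have px := valP x; rewrite /zred redp_pint //.
move/eqP; rewrite mulf_eq0 invr_eq0 (negPf (coprime_Fp_neq0 px)) orbF.
rewrite [numq _]intEsign rmorphM rmorph_sign mulf_eq0 signr_eq0 /= -pmulrn.
rewrite -(dvdn_pcharf (pchar_Fp p_pr)) => /dvdnP[n num_n].
have p_neq0 : p%:R != 0 :> rat by rewrite pnatr_eq0 -lt0n prime_gt0.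
have num_x : numq (val x) = (-1) ^+ (numq (val x) < 0)%R * n%:Z * p%:Z.
  by rewrite {1}[numq _]intEsign num_n PoszM mulrA.
have pint_y : val x / p%:R \in pint p.
  apply: (pint_frac px); rewrite mulrAC numq_natdiv num_x rmorphM /= -pmulrn.
  exact: mulfK.
by exists (Zloc pint_y); apply: val_inj; rewrite rmorphMn /= -mulr_natr mulfVK.
Qed.

End ZlocReduction.

(** * The exponential of a series and the Artin-Hasse series *)

Lemma coef0_fpsX (R : comNzRingType) (f : fps R) k : (f ^+ k) 0 = f 0 ^+ k.
Proof.
by elim: k => [|k IHk]; rewrite ?coef_fps1 // !exprS coef0_fpsM IHk.
Qed.

(** A k-th power has valuation at least k. *)
Lemma coef_fpsX_lt (R : comNzRingType) (f : fps R) k n :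
  f 0 = 0 -> (n < k)%N -> (f ^+ k) n = 0.
Proof.
move=> f0; elim: k n => // k IHk n lt_nk.
rewrite exprS coef_fpsM big_ord_recl f0 mul0r add0r big1 // => i _.
by rewrite IHk ?mulr0 // lift0; have := ltn_ord i; lia.
Qed.

Lemma fps_expE f n :
  fps_exp f n = \sum_(m < n.+1) (m`!%:R)^-1 * (Fps f ^+ m) n.
Proof.
rewrite /fps_exp coef_sum; apply: eq_bigr => m _; rewrite coefZ; congr (_ * _).
by apply: (@coef_fpsX_poly _ n.+1) => // i lt_in; rewrite coef_poly lt_in.
Qed.

Lemma fps_exp0 f : fps_exp f 0 = 1.
Proof. by rewrite fps_expE big_ord1 expr0 coef_fps1 fact0 invr1 mulr1. Qed.

Lemma fps_expE_widen f n N : f 0 = 0 -> (n < N)%N ->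
  fps_exp f n = \sum_(0 <= m < N) (m`!%:R)^-1 * (Fps f ^+ m) n.
Proof.
move=> f0 lt_nN; rewrite fps_expE (big_cat_nat (n := n.+1)) //= big_mkord.
rewrite [X in _ = _ + X]big_nat [X in _ = _ + X]big1 ?addr0 // => m /andP[lt_nm _].
by rewrite (@coef_fpsX_lt _ (Fps f) m n f0 lt_nm) mulr0.
Qed.

(** Differentiate F^m / m! termwise; by valuation, the truncations at which the
    coefficients are computed can be chosen uniformly. *)
Lemma theta_fps_exp f : f 0 = 0 ->
  theta (Fps (fps_exp f)) = theta (Fps f) * Fps (fps_exp f).
Proof.
move=> f0; apply: fpsP => -[|n].
  by rewrite coef0_fpsM !coef_theta !mulr0n mul0r.
have expE k : (k < n.+1)%N -> fps_exp f k =
    \sum_(0 <= m < n.+1) (m`!%:R)^-1 * (Fps f ^+ m) k.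
  exact: fps_expE_widen.
transitivity (\sum_(0 <= m < n.+1) (m`!%:R)^-1 * (theta (Fps f) * Fps f ^+ m) n.+1).
  rewrite coef_theta [Fps _ _]/= (fps_expE_widen f0 (ltnSn n.+1)) -sumrMnl.
  rewrite [LHS]big_nat_recl // expr0 coef_fps1 mulr0 mul0rn add0r.
  apply: eq_bigr => m _; rewrite -mulrnAr -coef_theta thetaXn coef_fpsMn.
  have nz_m : m.+1%:R != 0 :> rat by rewrite pnatr_eq0.
  have nz_f : m`!%:R != 0 :> rat by rewrite pnatr_eq0 -lt0n fact_gt0.
  rewrite [_ ^+ m * _]mulrC factS natrM; set x := fps_coef _ _.
  by field; rewrite nat1r; apply/andP.
under eq_bigr do rewrite coef_fpsM mulr_sumr.
rewrite exchange_big coef_fpsM; apply: eq_bigr => i _ /=.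
case: (posnP i) => [->|i_gt0].
  by rewrite mulr0n mul0r big1 // => m _; rewrite mul0r mulr0.
rewrite expE; last by lia.
by rewrite mulr_sumr; apply: eq_bigr => m _; rewrite mulrCA.
Qed.

Section ArtinHasseRat.
Variable p : nat.
Hypothesis p_pr : prime p.
Let p_gt0 : (0 < p)%N := prime_gt0 p_pr.
Let p_gt1 : (1 < p)%N := prime_gt1 p_pr.

Lemma theta_AH_log : theta (Fps (AH_log p)) = pow_series rat p.
Proof.
apply: fpsP => n; rewrite coef_theta /= /AH_log.
have [/p_natP[k n_pk]|p'n] := boolP (p.-nat n); last first.
  rewrite big_pred0 ?mul0rn // => i; apply: contraNF p'n => /eqP <-.
  by rewrite pnatX pnat_id.
have lt_kn : (k < n.+1)%N by rewrite n_pk ltnW // ltnS ltn_expl.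
rewrite (big_pred1 (Ordinal lt_kn)) => [|i]; last first.
  by rewrite /= -val_eqE /= -(eqn_exp2l i k p_gt1) -n_pk.
by rewrite /= -n_pk -[LHS]mulr_natr mulVf // pnatr_eq0 n_pk -lt0n expn_gt0 p_gt0.
Qed.

Lemma AH_log0 : AH_log p 0 = 0.
Proof.
rewrite /AH_log big_pred0 // => i.
by rewrite expn_eq0 (gtn_eqF p_gt0).
Qed.

Definition AH : fps rat := Fps (AH_coef p).

Lemma theta_AH : theta AH = pow_series rat p * AH.
Proof. by rewrite -theta_AH_log; apply: theta_fps_exp AH_log0. Qed.

Lemma AH_0 : AH 0 = 1. Proof. exact: fps_exp0. Qed.

Definition exp_pX : fps rat := Fps (fun n => (p ^ n)%:R / n`!%:R).

Lemma theta_exp_pX : theta exp_pX = fpsX * exp_pX *+ p.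
Proof.
apply: fpsP => n; rewrite coef_fpsMn coef_fpsXM coef_theta /=.
case: n => [|n]; first by rewrite mulr0n mul0rn.
have nz_n : n.+1%:R != 0 :> rat by rewrite pnatr_eq0.
have nz_f : n`!%:R != 0 :> rat by rewrite pnatr_eq0 -lt0n fact_gt0.
rewrite expnS factS !natrM; field; rewrite nat1r; exact/andP.
Qed.

(** Both sides have constant term 1 and logarithmic derivative p L, since
    L(X) = X + L(X^p). *)
Lemma AH_functional : AH ^+ p = dilate p AH * exp_pX.
Proof.
apply: (theta_unique (a := pow_series rat p *+ p)).
- move=> n x y n_gt0 eq_n.
  have n_neq0 : n%:R != 0 :> rat by rewrite pnatr_eq0 -lt0n.
  by apply: (mulIf n_neq0); rewrite !mulr_natr.
- by rewrite coef_fpsMn pow_series0 mul0rn.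
- rewrite -[in LHS](prednK p_gt0) thetaXn prednK // theta_AH mulrCA -exprSr.
  by rewrite prednK // mulrnAl.
- rewrite thetaM theta_dilate theta_AH theta_exp_pX dilateM //.
  rewrite [in RHS](pow_series_split rat p_pr); ring.
have dilate0 : dilate p AH 0 = AH 0 by rewrite /= dvdn0 div0n.
have exp0 : exp_pX 0 = 1 by rewrite /= expn0 fact0 divr1.
by rewrite coef0_fpsX coef0_fpsM dilate0 exp0 AH_0 expr1n mulr1.
Qed.

(** Each term n / p^(k+1) of the formula of Legendre is at most half of the
    previous one. *)
Lemma logn_fact_lt n : (0 < n)%N -> (logn p n`! < n)%N.
Proof.
move=> n_gt0; rewrite logn_fact //.
suff bound m : (\sum_(1 <= k < m.+1) n %/ p ^ k + maxn 1 (n %/ p ^ m) <= n)%N.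
  by have := bound n; lia.
elim: m => [|m IHm]; first by rewrite big_geq // expn0 divn1 add0n; lia.
rewrite big_nat_recr //= expnSr divnMA.
apply: leq_trans IHm; rewrite -addnA leq_add2l.
have := leq_trunc_div (n %/ p ^ m) p; nia.
Qed.

Lemma exp_pX_pint n : (0 < n)%N -> (p ^ n.-1)%:R / n`!%:R \in pint p.
Proof.
move=> n_gt0; have := logn_fact_lt n_gt0; set v := logn p n`! => lt_vn.
have [m co_pm fact_n] := pfactor_coprime p_pr (fact_gt0 n).
apply: (@pint_frac p _ (p ^ (n.-1 - v))%N%:Z m) => //.
have -> : (p ^ n.-1 = p ^ (n.-1 - v) * p ^ v)%N by rewrite -expnD subnK //; lia.
have nz_f : n`!%:R != 0 :> rat by rewrite pnatr_eq0 -lt0n fact_gt0.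
rewrite -pmulrn mulrAC -natrM -mulnA [(p ^ v * m)%N]mulnC -fact_n natrM.
by rewrite mulfK.
Qed.

(** The coefficient of index n + 1 occurs in the power only linearly, k times,
    multiplied by constant terms. *)
Lemma coef_fpsX_diff (f g : fps rat) n k : f 0 = 1 -> g 0 = 1 ->
    eq_upto n.+1 f g ->
  (f ^+ k) n.+1 - (g ^+ k) n.+1 = (f n.+1 - g n.+1) *+ k.
Proof.
move=> f0 g0 fg; elim: k => [|k IHk]; first by rewrite !expr0 subrr.
rewrite mulrSr -IHk !exprSr !coef_fpsM.
have split_sum (h : fps rat) : h 0 = 1 ->
    \sum_(i < n.+2) (h ^+ k) i * h (n.+1 - i)%N =
    h n.+1 + \sum_(i < n) (h ^+ k) (lift ord0 i) * h (n - i)%N + (h ^+ k) n.+1.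
  move=> h0; rewrite big_ord_recl big_ord_recr /= subnn h0 mulr1.
  by rewrite coef0_fpsX h0 expr1n mul1r subn0 addrA.
rewrite !split_sum //.
rewrite (eq_bigr (fun i : 'I_n => (g ^+ k) (lift ord0 i) * g (n - i)%N)).
  by ring.
move=> i _; have lt_in := ltn_ord i.
by rewrite (eq_uptoX k fg) ?fg //= /bump; lia.
Qed.

(** Suppose that the coefficients of index at most n are p-integral, and let V be
    the truncation.  In the coefficient of index n + 1 of U^p = U(X^p) exp(pX), the
    unknown coefficient u occurs only as p u; the rest is the difference of
    the coefficients of V(X^p) exp(pX) and of V^p, which is divisible by p because
    exp(pX) = 1 and V^p = V(X^p) modulo p. *)
Lemma AH_pint n : AH n \in pint p.
Proof.
elim/ltn_ind: n => -[|n] IHn; first by rewrite AH_0 rpred1.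
pose V : fps (zloc p) := Fps (fun i => if (i < n.+1)%N then insubd 0 (AH i) else 0).
(* ep is exp(pX) *)
pose ep : fps (zloc p) := Fps (fun i =>
  if i is 0 then 1 else insubd 0 ((p ^ i.-1)%:R / i`!%:R) *+ p).
have V_AH : eq_upto n.+1 AH (map_fps val V).
  by move=> i lt_in; rewrite coef_map_fps [V i]/= lt_in /= zvalK ?IHn.
have ep_exp : map_fps val ep = exp_pX.
  apply: fpsP => -[|i]; first by rewrite /= expn0 fact0 divr1.
  rewrite coef_map_fps [ep _]/= rmorphMn /= zvalK ?exp_pX_pint //.
  by rewrite -mulr_natr mulrAC -natrM -expnSr.
have red_ep : map_fps (zred p_pr) ep = 1.
  apply: fpsP => -[|i]; rewrite coef_map_fps coef_fps1 ?rmorph1 // [ep _]/=.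
  by rewrite rmorphMn /= (mulrn_pchar (pchar_Fp p_pr)).
pose s : zloc p := (dilate p V * ep - V ^+ p) n.+1.
have s_AH : val s = AH n.+1 *+ p.
  have V0 : map_fps val V 0 = 1 by rewrite -V_AH ?AH_0.
  have Vn : map_fps val V n.+1 = 0 by rewrite coef_map_fps [V _]/= ltnn rmorph0.
  have := coef_fpsX_diff p AH_0 V0 V_AH; rewrite Vn subr0 => <-.
  have map_s : map_fps val (dilate p V * ep - V ^+ p) =
      dilate p (map_fps val V) * exp_pX - map_fps val V ^+ p.
    by rewrite rmorphB rmorphM rmorphXn /= map_dilate ep_exp.
  rewrite AH_functional -(coef_map_fps val) map_s coef_fpsD coef_fpsN.
  congr (_ - _).
  apply: (@eq_uptoM _ n.+2) => // i lt_in /=; case: ifP => // /dvdnP[j i_jp].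
  rewrite i_jp mulnK //; apply/esym/V_AH.
  by move: lt_in; rewrite i_jp; nia.
have [y s_y] : exists y, s = y *+ p.
  apply: (zred_ker (p_pr := p_pr)).
  have red_s : map_fps (zred p_pr) (dilate p V * ep - V ^+ p) = 0.
    rewrite rmorphB rmorphM rmorphXn /= red_ep mulr1 map_dilate.
    by rewrite (fps_Frobenius _ (pchar_Fp p_pr) (Fp_expp p_pr)) subrr.
  by rewrite -(coef_map_fps (zred p_pr)) red_s coef_fps0.
have p_neq0 : p%:R != 0 :> rat by rewrite pnatr_eq0 -lt0n.
have -> : AH n.+1 = val y.
  by apply: (mulIf p_neq0); rewrite !mulr_natr -s_AH s_y rmorphMn.
exact: valP.
Qed.

End ArtinHasseRat.

(** * Bernoulli numbers modulo p *)

Section BernoulliModp.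
Variable p : nat.
Hypothesis p_pr : prime p.

(** The recurrence for index n divides by n + 1, which is less than p. *)
Lemma bernoulli_pint n : (n.+1 < p)%N -> bernoulli n \in pint p.
Proof.
elim/ltn_ind: n => -[_ _|n IHn lt_np]; first by rewrite bernoulli0 rpred1.
have n2_neq0 : n.+2%:R != 0 :> rat by rewrite pnatr_eq0.
have inv_n2 : (n.+2%:R)^-1 \in pint p.
  apply: (@pint_frac p _ 1 n.+2); last by rewrite mulVf.
  by rewrite prime_coprime // gtnNdvd.
have := bernoulliE (ltn0Sn n); rewrite big_ord_recr /= binSn addrC => /eqP.
rewrite addr_eq0 => /eqP sumE.
have -> : bernoulli n.+1 = - (\sum_(i < n.+1) 'C(n.+2, i)%:R * bernoulli i) / n.+2%:R.
  by rewrite -sumE mulrC mulKf.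
rewrite rpredM // rpredN rpred_sum // => i _; rewrite rpredM ?rpred_nat //.
by apply: IHn; [rewrite ltn_ord | have := ltn_ord i; lia].
Qed.

Lemma bernoulli_modp_rec n : (1 < n < p)%N ->
  \sum_(i < n) 'C(n, i)%:R * redp p (bernoulli i) = 0.
Proof.
case: n => [|[|n]] // lt_np.
pose b i : zloc p := insubd 0 (bernoulli i).
have bE i : (i < n.+2)%N -> zval (b i) = bernoulli i.
  by move=> lt_in; apply/zvalK/bernoulli_pint; lia.
transitivity (zred p_pr (\sum_(i < n.+2) 'C(n.+2, i)%:R * b i)).
  rewrite rmorph_sum; apply: eq_bigr => i _.
  by rewrite rmorphM rmorph_nat /= /zred /= bE.
rewrite -(rmorph0 (zred p_pr)); congr (zred _ _); apply: val_inj.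
rewrite rmorph_sum rmorph0; apply: etrans (bernoulliE (ltn0Sn n)).
apply: eq_bigr => i _.
by rewrite rmorphM rmorph_nat /= bE.
Qed.

End BernoulliModp.

(** * The theorem *)

Theorem theorem1p4 (p : nat) (p_prime : prime p) (p_odd : odd p)
    (k : nat) (k_ge1 : (1 <= k)%N) (k_lt : (k < p ^ 2 - 1)%N) :
  (exists! dj : nat * nat,
     (1 <= dj.1 <= p - 1)%N /\ k = (dj.1 + dj.2 * (p - 1))%N) /\
  (forall d j : nat,
     (1 <= d <= p - 1)%N -> k = (d + j * (p - 1))%N ->
     W p k = 'C(d - 1, j)%:R * lambda p d + (d == 1%N)%:R * c p j).
Proof.
have p_gt1 := prime_gt1 p_prime.
split.
  have p1_gt0 : (0 < p - 1)%N by rewrite subn_gt0.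
  exists ((k.-1 %% (p - 1)).+1, k.-1 %/ (p - 1))%N; split=> /=.
    split; first by rewrite ltn_mod.
    by rewrite addSn addnC -divn_eq prednK.
  case=> d j /= [d_range kE]; apply/eqP; rewrite xpair_eqE.
  rewrite -(digits_uniq (m := p - 1)) //; last by rewrite /= ltn_mod.
  by rewrite addSn addnC -divn_eq prednK // kE.
move=> d j d_range kE.
have [Q QE] := divided_falling_exists p_prime (zred_ker (p_pr := p_prime)).
pose U : fps (zloc p) := Fps (fun n => insubd 0 (AH p n)).
have U_AH : map_fps val U = AH p.
  by apply: fpsP => n; rewrite coef_map_fps /= zvalK // AH_pint.
have val_fps_inj : injective (map_fps (val : {rmorphism zloc p -> rat})).
  move=> f g fg; apply: fpsP => n; apply: val_inj.
  by have := congr1 (fun h : fps rat => h n) fg.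
have U0 : U 0 = 1.
  by apply: val_inj; rewrite -(coef_map_fps val) U_AH AH_0.
have U_ode : theta U = pow_series (zloc p) p * U.
  apply: val_fps_inj; rewrite map_theta rmorphM /= map_pow_series U_AH.
  exact: theta_AH.
have redU n : AH_coef_modp p n = zred p_prime (U n).
  by rewrite /zred -[\val _]/(zval _) zvalK ?AH_pint.
have lt_d : (0 < d < p)%N by lia.
have kE' : k = (d + j * p.-1)%N by rewrite kE subn1.
rewrite /W; under eq_bigr => r _ do rewrite !redU.
have := @coef_twisted_square p _ (zred p_prime) p_prime p_odd
  (@zloc_torsion_free p) (zred_ker (p_pr := p_prime)) Q QE U U0 U_ode d j lt_d.
rewrite -kE' => /(_ k_lt) ->; congr (_ * _ + _); first by rewrite subn1.
rewrite /lambda; case: eqP => [->|/eqP d_neq1].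
  rewrite (divided_falling1 p_prime p_odd (@zloc_torsion_free p) QE).
  by rewrite rmorph_nat.
apply: (@divided_falling_bernoulli p _ (zred p_prime) p_prime p_odd
  (@zloc_torsion_free p) Q QE (fun i => redp p (bernoulli i))).
- by rewrite bernoulli0; exact: rmorph1 (zred p_prime).
- by move=> n; apply: bernoulli_modp_rec.
lia.
Qed.
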